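(* Let $N \geq 1$ be an integer and let $\lambda$ be a real number. Suppose that either (i) $N$ is even and $\lambda \in [0, \lambda_0]$, where $\lambda_0$ is the unique root of the Bernoulli polynomial $B_N$ in $[0, 1/2]$; or (ii) $N$ is odd and $\lambda \in [\lambda_0, 1/2]$, where $\lambda_0$ is the unique root of the Bernoulli polynomial $B_{N+1}$ in $[0, 1/2]$. Then the function $$x \mapsto (-1)^{\lceil N/2 \rceil} \bigl( \log \Gamma(x) - L_N(\lambda; x) \bigr)$$ is strictly completely monotonic on $(\lambda, \infty)$.
   Context: $\Gamma$ is the Euler gamma function. $B_n(\lambda)$ denotes the $n$th Bernoulli polynomial, with generating function $\frac{z e^{\lambda z}}{e^z - 1} = \sum_{n \ge 0} B_n(\lambda) \frac{z^n}{n!}$. For an integer $N \ge 1$, and real $x > \lambda$, $$L_N(\lambda; x) := \log\sqrt{2\pi} + \left(x - \tfrac12\right) \log(x - \lambda) - (x - \lambda) + \sum_{n=2}^{N} (-1)^n \frac{B_n(\lambda)}{n(n-1)} (x - \lambda)^{1-n}$$ (the sum is empty if $N = 1$). A function $f$ is strictly completely monotonic on an interval or half-line $I$ if, for all $x \in I$ and all integers $n \ge 0$, the derivative $f^{(n)}(x)$ exists and satisfies $(-1)^n f^{(n)}(x) > 0$. *)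

(* Defs.v *)
From Stdlib Require Import Reals Lra Lia Arith Factorial ClassicalEpsilon.
From Coquelicot Require Import Coquelicot.
Open Scope R_scope.

(* Euler's integral, improper at both ends; meaningful for x > 0. *)
Definition Gamma (x : R) : R :=
  RInt_gen (fun t => Rpower t (x - 1) * exp (- t))
           (at_right 0) (Rbar_locally p_infty).

(* [locally' 0] is the filter of punctured neighbourhoods of 0: the generating
   function z e^(l z) / (e^z - 1) has a removable singularity there. *)
Definition has_bernoulli_gf (l : R) (B : nat -> R) : Prop :=
  locally' 0 (fun z : R =>
    is_series (fun n => B n * (z ^ n / INR (fact n)))
              (z * exp (l * z) / (exp z - 1))).

(* coefficients of (e^z - 1) / z *)
Definition shexp (n : nat) : R := / INR (fact (S n)).

Fixpoint recip_fuel (f n : nat) : R :=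
  match f, n with
  | O, _ => 0
  | S _, O => 1
  | S f', S m => - sum_f_R0 (fun k => recip_fuel f' k * shexp (S m - k)) m
  end.

(* coefficients of z / (e^z - 1) *)
Definition recip (n : nat) : R := recip_fuel (S n) n.

Lemma recip_fuel_eq f n : (n < f)%nat -> recip_fuel f n = recip n.
Proof.
revert f; induction n as [n IH] using (well_founded_induction lt_wf).
intros [|f] Hf; [lia|]; destruct n as [|m]; [reflexivity|].
unfold recip; cbn [recip_fuel]; f_equal; apply sum_eq; intros k Hk.
transitivity (recip k * shexp (S m - k)).
- rewrite <- (IH k ltac:(lia) f ltac:(lia)); reflexivity.
- rewrite <- (IH k ltac:(lia) (S m) ltac:(lia)); reflexivity.
Qed.

Lemma recip_S m : recip (S m) = - sum_f_R0 (fun k => recip k * shexp (S m - k)) m.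
Proof.
unfold recip at 1; cbn [recip_fuel]; f_equal; apply sum_eq; intros k Hk.
rewrite <- (recip_fuel_eq (S m) k) by lia; reflexivity.
Qed.

Lemma recip_mult n :
  PS_mult recip shexp n = match n with O => 1 | S _ => 0 end.
Proof.
unfold PS_mult; destruct n as [|m].
- simpl; unfold recip, shexp; simpl; field.
- cbn [sum_f_R0]; rewrite (recip_S m), Nat.sub_diag.
  unfold shexp at 3; simpl; field.
Qed.

Lemma shexp_bound n : Rabs (shexp n) <= (/ 2) ^ n.
Proof.
unfold shexp.
rewrite Rabs_pos_eq by (apply Rlt_le, Rinv_0_lt_compat, INR_fact_lt_0).
rewrite pow_inv; apply Rinv_le_contravar; [apply pow_lt; lra|].
induction n as [|n IH]; [simpl; lra|].
change (fact (S (S n))) with (S (S n) * fact (S n))%nat.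
rewrite mult_INR; cbn [pow]; apply Rmult_le_compat; try lra.
- apply pow_le; lra.
- rewrite !S_INR; pose proof (pos_INR n); lra.
Qed.

Lemma half_sum m : sum_f_R0 (fun k => (/ 2) ^ (S m - k)) m = 1 - (/ 2) ^ S m.
Proof.
induction m as [|m IH]; [simpl; lra|].
cbn [sum_f_R0]; replace (S (S m) - S m)%nat with 1%nat by lia.
rewrite (sum_eq _ (fun k => (/ 2) ^ (S m - k) * (/ 2))).
- rewrite <- scal_sum, IH; simpl; field.
- intros k Hk; replace (S (S m) - k)%nat with (S (S m - k)) by lia; simpl; ring.
Qed.

Lemma recip_bound n : Rabs (recip n) <= 1.
Proof.
induction n as [n IH] using (well_founded_induction lt_wf).
destruct n as [|m]; [unfold recip; simpl; rewrite Rabs_R1; lra|].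
rewrite recip_S, Rabs_Ropp.
eapply Rle_trans; [apply Rsum_abs|].
eapply Rle_trans; [apply sum_Rle with (Bn := fun k => (/ 2) ^ (S m - k))|].
- intros k Hk; rewrite Rabs_mult.
  pose proof (IH k ltac:(lia)); pose proof (shexp_bound (S m - k)).
  pose proof (Rabs_pos (recip k)); pose proof (Rabs_pos (shexp (S m - k))); nra.
- rewrite half_sum; pose proof (pow_lt (/ 2) (S m) ltac:(lra)); lra.
Qed.

Lemma CV_radius_ge (a : nat -> R) (x : R) :
  ex_pseries a x -> Rbar_le x (CV_radius a).
Proof.
intros [s Hs]; apply is_pseries_R in Hs.
apply (proj1 (CV_radius_bounded a)).
destruct (filterlim_bounded (fun n => a n * x ^ n)) as [M HM].
- exists 0; apply ex_series_lim_0; exists s; exact Hs.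
- exists M; exact HM.
Qed.

Lemma CV_radius_gt (a : nat -> R) (x z : R) :
  ex_pseries a x -> Rabs z < x -> Rbar_lt (Rabs z) (CV_radius a).
Proof.
intros Ha Hz; apply Rbar_lt_le_trans with x; [exact Hz|now apply CV_radius_ge].
Qed.

Lemma is_series_extR (a b : nat -> R) (s : R) :
  (forall n, a n = b n) -> is_series a s -> is_series b s.
Proof. exact (is_series_ext a b s). Qed.

(* coefficients of e^(l z) *)
Definition expc (l : R) (n : nat) : R := l ^ n / INR (fact n).

Lemma is_pseries_expc l z : is_pseries (expc l) z (exp (l * z)).
Proof.
apply is_pseries_R; generalize (proj1 (is_pseries_R _ _ _) (is_exp_Reals (l * z))).
apply is_series_extR; intros n; unfold expc; rewrite Rpow_mult_distr.
unfold Rdiv; ring.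
Qed.

Lemma is_pseries_shexp z : z <> 0 -> is_pseries shexp z ((exp z - 1) / z).
Proof.
intros Hz.
replace ((exp z - 1) / z) with (/ z * (exp z + - / INR (fact 0)))
  by (simpl; field; exact Hz).
apply (is_pseries_decr_1 (fun n => / INR (fact n)) z (/ z) (exp z)).
- exact (Rinv_l z Hz).
- apply is_exp_Reals.
Qed.

Lemma exp_m1_neq0 z : z <> 0 -> exp z - 1 <> 0.
Proof.
intros Hz H; apply Hz, exp_inv; rewrite exp_0; lra.
Qed.

Lemma recip_radius z : Rabs z < 1 -> Rbar_lt (Rabs z) (CV_radius recip).
Proof.
intros Hz; apply Rbar_lt_le_trans with 1; [exact Hz|].
apply (proj1 (CV_radius_bounded recip)); exists 1; intros n.
rewrite pow1, Rmult_1_r; apply recip_bound.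
Qed.

Lemma expc_radius l z : Rabs z < 1 -> Rbar_lt (Rabs z) (CV_radius (expc l)).
Proof.
intros Hz; apply CV_radius_gt with 1; [|exact Hz].
eexists; apply is_pseries_expc.
Qed.

Lemma is_pseries_recip z :
  z <> 0 -> Rabs z < 1 -> is_pseries recip z (z / (exp z - 1)).
Proof.
intros Hz Hz1; pose proof (exp_m1_neq0 z Hz) as He.
destruct (CV_radius_inside recip z (recip_radius z Hz1)) as [s Hs].
assert (Hm : is_pseries (PS_mult recip shexp) z (s * ((exp z - 1) / z))).
{ apply is_pseries_mult; [exact Hs|now apply is_pseries_shexp|now apply recip_radius|].
  apply CV_radius_gt with 1; [|exact Hz1].
  eexists; apply is_pseries_shexp; lra. }
assert (H1 : is_pseries (PS_mult recip shexp) z 1).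
{ apply is_pseries_R; unfold is_series.
  apply filterlim_ext with (f := fun _ : nat => 1); [|apply filterlim_const].
  intros n; rewrite sum_n_Reals; induction n as [|n IH].
  - simpl; rewrite recip_mult; ring.
  - cbn [sum_f_R0]; rewrite <- IH, recip_mult; ring. }
apply is_pseries_unique in Hm; apply is_pseries_unique in H1.
replace (z / (exp z - 1)) with s; [exact Hs|].
assert (E : s * ((exp z - 1) / z) = 1) by congruence.
apply Rmult_eq_reg_r with ((exp z - 1) / z); [rewrite E; field; auto|].
unfold Rdiv; apply Rmult_integral_contrapositive_currified; auto.
apply Rinv_neq_0_compat; exact Hz.
Qed.

Lemma bernoulli_gf_pseries l z : z <> 0 -> Rabs z < 1 ->
  is_pseries (PS_mult (expc l) recip) z (z * exp (l * z) / (exp z - 1)).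
Proof.
intros Hz Hz1.
replace (z * exp (l * z) / (exp z - 1))
  with (exp (l * z) * (z / (exp z - 1))) by (field; now apply exp_m1_neq0).
apply is_pseries_mult;
  auto using is_pseries_expc, is_pseries_recip, expc_radius, recip_radius.
Qed.

Lemma bernoulli_gf_exists l : exists B, has_bernoulli_gf l B.
Proof.
exists (fun n => INR (fact n) * PS_mult (expc l) recip n).
exists (mkposreal 1 Rlt_0_1); intros z Hz Hz0.
assert (Hz1 : Rabs z < 1).
{ revert Hz; unfold ball; simpl; unfold AbsRing_ball, abs, minus, plus, opp; simpl.
  now rewrite Ropp_0, Rplus_0_r. }
generalize (proj1 (is_pseries_R _ _ _) (bernoulli_gf_pseries l z Hz0 Hz1)).
apply is_series_extR; intros n; field; apply INR_fact_neq_0.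
Qed.

(* The Bernoulli polynomial B_n, as a function of l: the n-th coefficient of
   the exponential generating function. *)
Definition bernoulli (n : nat) (l : R) : R :=
  proj1_sig (constructive_indefinite_description _ (bernoulli_gf_exists l)) n.

Lemma bernoulli_gf l : has_bernoulli_gf l (fun n => bernoulli n l).
Proof.
exact (proj2_sig (constructive_indefinite_description _ (bernoulli_gf_exists l))).
Qed.

Lemma bernoulli_gf_coef l (B : nat -> R) :
  has_bernoulli_gf l B ->
  forall n, B n = INR (fact n) * PS_mult (expc l) recip n.
Proof.
intros [eps HB] n.
set (a := fun n => B n / INR (fact n)).
assert (Ha : forall z, z <> 0 -> Rabs z < eps ->
               is_pseries a z (z * exp (l * z) / (exp z - 1))).
{ intros z Hz0 Hz; apply is_pseries_R.
  assert (Hb : ball 0 eps z).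
  { unfold ball; simpl; unfold AbsRing_ball, abs, minus, plus, opp; simpl.
    now rewrite Ropp_0, Rplus_0_r. }
  generalize (HB z Hb Hz0); apply is_series_extR; intros k; unfold a.
  field; apply INR_fact_neq_0. }
enough (E : a n = PS_mult (expc l) recip n).
{ rewrite <- E; unfold a; field; apply INR_fact_neq_0. }
assert (Hpos : forall (c : nat -> R) r,
          0 < r -> ex_pseries c r -> Rbar_lt 0 (CV_radius c)).
{ intros c r Hr Hc; apply Rbar_lt_le_trans with r; [exact Hr|].
  now apply CV_radius_ge. }
pose proof (cond_pos eps) as He.
change (PS_incr_1 a (S n) = PS_incr_1 (PS_mult (expc l) recip) (S n)).
apply PSeries_ext_recip; rewrite ?CV_radius_incr_1.
- apply Hpos with (eps / 2); [lra|]; eexists; apply Ha; [lra|].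
  rewrite Rabs_pos_eq; lra.
- apply Hpos with (/ 2); [lra|]; eexists; apply bernoulli_gf_pseries; [lra|].
  rewrite Rabs_pos_eq; lra.
- assert (Hm : 0 < Rmin eps 1) by (apply Rmin_pos; lra).
  exists (mkposreal _ Hm); intros z Hz.
  assert (Hz1 : Rabs z < Rmin eps 1).
  { revert Hz; unfold ball; simpl; unfold AbsRing_ball, abs, minus, plus, opp; simpl.
    now rewrite Ropp_0, Rplus_0_r. }
  pose proof (Rmin_l eps 1); pose proof (Rmin_r eps 1).
  rewrite !PSeries_incr_1.
  destruct (Req_dec z 0) as [->|Hz0]; [now rewrite !Rmult_0_l|].
  rewrite (is_pseries_unique _ _ _ (Ha z Hz0 ltac:(lra))).
  rewrite (is_pseries_unique _ _ _ (bernoulli_gf_pseries l z Hz0 ltac:(lra))).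
  reflexivity.
Qed.

Lemma bernoulli_gf_unique l (B : nat -> R) :
  has_bernoulli_gf l B -> forall n, B n = bernoulli n l.
Proof.
intros HB n; rewrite (bernoulli_gf_coef l B HB).
symmetry; exact (bernoulli_gf_coef l _ (bernoulli_gf l) n).
Qed.

(* B_n(l) / n! *)
Definition nbern (n : nat) (l : R) : R := PS_mult (expc l) recip n.

Lemma bernoulliE n l : bernoulli n l = INR (fact n) * nbern n l.
Proof. exact (bernoulli_gf_coef l _ (bernoulli_gf l) n). Qed.

Lemma is_derive_expc_sum (d : nat -> R) n (l : R) :
  is_derive (fun x : R => sum_f_R0 (fun k => expc x k * d k) (S n)) l
            (sum_f_R0 (fun k => expc l k * d (S k)) n).
Proof.
assert (E : forall k, is_derive (fun x : R => expc x (S k) * d (S k)) l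
                                (expc l k * d (S k))).
{ intros k; unfold expc; auto_derive; [trivial|].
  change (fact k + k * fact k)%nat with (S k * fact k)%nat; rewrite mult_INR.
  change (match k with 0%nat => 1 | S _ => INR k + 1 end) with (INR (S k)).
  field; split; [apply INR_fact_neq_0|apply not_0_INR; lia]. }
induction n as [|n IH].
- apply is_derive_ext with (f := fun x => d 0%nat + expc x 1 * d 1%nat).
  + intros x; unfold expc; simpl; field.
  + replace (sum_f_R0 (fun k => expc l k * d (S k)) 0)
      with (0 + expc l 0 * d 1%nat) by (simpl; ring).
    apply (is_derive_plus (fun _ => d 0%nat)); [apply @is_derive_const|apply E].
- exact (is_derive_plus _ _ _ _ _ IH (E (S n))).
Qed.

Lemma is_derive_nbern n l : is_derive (nbern (S n)) l (nbern n l).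
Proof. exact (is_derive_expc_sum (fun k => recip (S n - k)) n l). Qed.

Lemma nbern_0 n : nbern n 0 = recip n.
Proof.
unfold nbern, PS_mult; destruct n as [|n]; [unfold expc; simpl; field|].
rewrite decomp_sum by lia; rewrite (sum_eq _ (fun _ => 0)).
- rewrite sum_cte; unfold expc; simpl pred; simpl fact.
  rewrite Nat.sub_0_r; simpl; field.
- intros k _; unfold expc, Rdiv; simpl pow; ring.
Qed.

Lemma nbern_1 n : nbern (S (S n)) 1 = nbern (S (S n)) 0.
Proof.
rewrite nbern_0; unfold nbern, PS_mult; rewrite <- sum_f_R0_skip.
cbn [sum_f_R0].
pose proof (recip_mult (S n)) as H; unfold PS_mult in H; cbn [sum_f_R0] in H.
rewrite <- (Rplus_0_l (recip (S (S n)))), <- H.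
assert (E : forall k, (k <= S n)%nat ->
  expc 1 (S (S n) - k) * recip (S (S n) - (S (S n) - k)) =
  recip k * shexp (S n - k)).
{ intros k Hk; replace (S (S n) - (S (S n) - k))%nat with k by lia.
  replace (S (S n) - k)%nat with (S (S n - k)) by lia.
  unfold expc, shexp; rewrite pow1; unfold Rdiv; ring. }
rewrite (sum_eq _ (fun k => recip k * shexp (S n - k)) n)
  by (intros k Hk; apply E; lia).
rewrite (E (S n)) by lia.
replace (S (S n) - S (S n))%nat with 0%nat by lia.
rewrite Nat.sub_0_r; unfold expc at 1; simpl fact; simpl pow.
unfold Rdiv; rewrite INR_1, Rinv_1; ring.
Qed.

Lemma nbern_sym n l : nbern n (1 - l) = (-1) ^ n * nbern n l.
Proof.
enough (H : (-1) ^ n * bernoulli n l = bernoulli n (1 - l)).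
{ rewrite !bernoulliE in H.
  apply Rmult_eq_reg_l with (INR (fact n)); [|apply INR_fact_neq_0].
  rewrite <- H; ring. }
apply (bernoulli_gf_unique (1 - l) (fun n => (-1) ^ n * bernoulli n l)).
exists (mkposreal 1 Rlt_0_1); intros z Hz Hz0.
assert (Hz1 : Rabs (- z) < 1).
{ rewrite Rabs_Ropp.
  revert Hz; unfold ball; simpl; unfold AbsRing_ball, abs, minus, plus, opp; simpl.
  now rewrite Ropp_0, Rplus_0_r. }
pose proof (proj1 (is_pseries_R _ _ _)
  (bernoulli_gf_pseries l (- z) (Ropp_neq_0_compat _ Hz0) Hz1)) as H.
replace (z * exp ((1 - l) * z) / (exp z - 1))
  with (- z * exp (l * - z) / (exp (- z) - 1)).
- revert H; apply is_series_extR; intros k; rewrite bernoulliE.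
  change (PS_mult (expc l) recip k) with (nbern k l).
  replace ((- z) ^ k) with ((-1) ^ k * z ^ k)
    by (rewrite <- Rpow_mult_distr; f_equal; ring).
  field; apply INR_fact_neq_0.
- replace ((1 - l) * z) with (z + l * - z) by ring.
  rewrite exp_plus, exp_Ropp; pose proof (exp_pos z).
  pose proof (exp_m1_neq0 z Hz0); field; repeat split; lra.
Qed.

Lemma nbern_half k : nbern (2 * k + 1) (/ 2) = 0.
Proof.
pose proof (nbern_sym (2 * k + 1) (/ 2)) as H.
replace (1 - / 2) with (/ 2) in H by field.
rewrite pow_add, pow_1_even in H; lra.
Qed.

Lemma nbern_odd_0 k : nbern (2 * S k + 1) 0 = 0.
Proof.
pose proof (nbern_sym (2 * S k + 1) 0) as H.
rewrite Rminus_0_r, pow_add, pow_1_even in H.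
replace (2 * S k + 1)%nat with (S (S (2 * k + 1))) in * by lia.
rewrite nbern_1 in H; lra.
Qed.

Lemma nbern_mvt n a b : a < b ->
  exists c, nbern (S n) b - nbern (S n) a = nbern n c * (b - a) /\ a < c < b.
Proof.
intros Hab; apply MVT_cor2; [exact Hab|].
intros c _; apply is_derive_Reals, is_derive_nbern.
Qed.

Lemma nbern_root k : (1 <= k)%nat ->
  (forall x, 0 < x < / 2 -> 0 < (-1) ^ k * nbern (2 * k - 1) x) ->
  exists r, 0 < r < / 2 /\ nbern (2 * k) r = 0 /\
    forall x y, 0 <= x -> x < y -> y <= / 2 ->
      (-1) ^ k * nbern (2 * k) x < (-1) ^ k * nbern (2 * k) y.
Proof.
intros Hk Hpos.
destruct (nbern_mvt (2 * k) 0 (/ 2)) as [r [Hr Hr2]]; [lra|].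
exists r; split; [exact Hr2|]; split.
- destruct k as [|k]; [lia|].
  replace (S (2 * S k)) with (2 * S k + 1)%nat in Hr by lia.
  rewrite nbern_half, nbern_odd_0 in Hr; lra.
- intros x y Hx Hxy Hy.
  destruct (nbern_mvt (2 * k - 1) x y Hxy) as [c [Hc Hc2]].
  replace (S (2 * k - 1)) with (2 * k)%nat in Hc by lia.
  pose proof (Hpos c ltac:(lra)).
  assert (0 < (-1) ^ k * nbern (2 * k - 1) c * (y - x))
    by (apply Rmult_lt_0_compat; lra).
  replace (nbern (2 * k) y) with
    (nbern (2 * k) x + nbern (2 * k - 1) c * (y - x)) by lra.
  lra.
Qed.

Lemma nbern_odd_sign k x :
  0 < x < / 2 -> 0 < (-1) ^ S k * nbern (2 * k + 1) x.
Proof.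
revert x; induction k as [|k IH]; intros x Hx.
- replace (nbern (2 * 0 + 1) x) with (x - / 2); [simpl; lra|].
  unfold nbern, PS_mult, expc, recip; simpl; unfold shexp; simpl; field.
- destruct (nbern_root (S k)) as [r [Hr [Hr0 Hm]]]; [lia| |].
  { intros y Hy; replace (2 * S k - 1)%nat with (2 * k + 1)%nat by lia; auto. }
  replace (2 * S k + 1)%nat with (S (2 * S k)) by lia.
  change ((-1) ^ S (S k)) with (-1 * (-1) ^ S k).
  destruct (Rle_lt_dec x r) as [Hxr|Hxr].
  + destruct (nbern_mvt (2 * S k) 0 x) as [c [Hc Hc2]]; [lra|].
    pose proof (Hm c r ltac:(lra) ltac:(lra) ltac:(lra)) as Hs.
    pose proof (nbern_odd_0 k) as H0.
    replace (2 * S k + 1)%nat with (S (2 * S k)) in H0 by lia.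
    rewrite H0 in Hc; rewrite Hr0 in Hs.
    replace (nbern (S (2 * S k)) x) with (nbern (2 * S k) c * x) by lra.
    nra.
  + destruct (nbern_mvt (2 * S k) x (/ 2)) as [c [Hc Hc2]]; [lra|].
    pose proof (Hm r c ltac:(lra) ltac:(lra) ltac:(lra)) as Hs.
    pose proof (nbern_half (S k)) as H0.
    replace (2 * S k + 1)%nat with (S (2 * S k)) in H0 by lia.
    rewrite H0 in Hc; rewrite Hr0 in Hs.
    replace (nbern (S (2 * S k)) x)
      with (- (nbern (2 * S k) c * (/ 2 - x))) by lra.
    nra.
Qed.

Definition is_half_root (n : nat) (r : R) : Prop :=
  0 <= r <= 1 / 2 /\ bernoulli n r = 0.

Lemma half_root_exists_unique n :
  (1 <= n)%nat -> Nat.Even n -> exists! r, is_half_root n r.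
Proof.
intros Hn [k ->].
destruct (nbern_root k) as [r [Hr [Hr0 Hm]]]; [lia| |].
{ intros x Hx; destruct k as [|k]; [lia|].
  replace (2 * S k - 1)%nat with (2 * k + 1)%nat by lia.
  now apply nbern_odd_sign. }
exists r; split.
- split; [lra|]; rewrite bernoulliE, Hr0; ring.
- intros y [Hy Hy0]; rewrite bernoulliE in Hy0.
  apply Rmult_integral in Hy0.
  destruct Hy0 as [Hy0|Hy0]; [now apply INR_fact_neq_0 in Hy0|].
  destruct (Rtotal_order r y) as [H|[H|H]]; [|exact H|].
  + pose proof (Hm r y ltac:(lra) H ltac:(lra)) as E.
    rewrite Hr0, Hy0 in E; lra.
  + pose proof (Hm y r ltac:(lra) H ltac:(lra)) as E.
    rewrite Hr0, Hy0 in E; lra.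
Qed.

Definition L (N : nat) (l x : R) : R :=
  ln (sqrt (2 * PI)) + (x - 1 / 2) * ln (x - l) - (x - l)
  + sum_n_m (fun n : nat =>
      (-1) ^ n * (bernoulli n l / (INR n * (INR n - 1)))
      * powerRZ (x - l) (1 - Z.of_nat n)) 2 N.

(* Derivatives are two-sided, so [D] is meant to be open. *)
Definition strictly_completely_monotonic (D : R -> Prop) (f : R -> R) : Prop :=
  forall (x : R) (n : nat), D x ->
    ex_derive_n f n x /\ 0 < (-1) ^ n * Derive_n f n x.

(* Main.v *)
(* Write f = ln Gamma - L and s = (-1)^ceil(N/2).  Stirling's formula gives
   f(x + n) -> 0, so f(x) is the sum over k >= 0 of d(x + k), where
   d(x) = f(x) - f(x + 1) is elementary; it suffices that s d is strictly
   completely monotonic.  With y = x - lambda, every derivative of d'' is a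
   combination of terms k!/a^(k+1), the Laplace transforms of t^k, and
     (-1)^m d^(m+2)(x) = int_0^oo t^m e^(-y t) (1 - e^(-t)) R(t) dt,
   where R is the remainder after the t^N term of the generating function
   t e^((1 - lambda) t) / (e^t - 1).  As d -> 0 along x + n, the signs of d'
   and d follow from convexity.

   For s R > 0, let R_n(x, t) be the remainder of t e^(x t) / (e^t - 1) after n
   terms.  Since d/dx R_(n+1) = t R_n and R_n(0, t) = R_n(1, t) for n >= 2, the
   induction that locates the roots of the Bernoulli polynomials gives the sign
   of the remainder at x = 1 for even N.  The derivative of e^(-x t) R_(n+1)
   in x is t^(n+1) e^(-x t) B_n(x) / n!, of constant sign on the relevant
   intervals, which carries the sign over to x = 1 - lambda. *)
Require Import Defs.
From Stdlib Require Import Reals Lra Lia Arith Factorial.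
From Coquelicot Require Import Coquelicot.
Open Scope R_scope.

(** * Improper integrals on the half-line *)

Lemma is_derive_mvt (F f : R -> R) (a b : R) :
  a < b -> (forall t, a <= t <= b -> is_derive F t (f t)) ->
  exists c, F b - F a = f c * (b - a) /\ a < c < b.
Proof.
intros Hab HF; apply MVT_cor2; [exact Hab|].
intros c Hc; apply is_derive_Reals; auto.
Qed.

Lemma is_derive_le (F f : R -> R) (a b : R) :
  a <= b -> (forall t, a <= t <= b -> is_derive F t (f t)) ->
  (forall t, a < t < b -> 0 <= f t) -> F a <= F b.
Proof.
intros Hab HF Hf; destruct (Req_dec a b) as [->|Hne]; [lra|].
destruct (is_derive_mvt F f a b) as [c [Hc Hc2]]; [lra|exact HF|].
pose proof (Hf c Hc2); nra.
Qed.

Lemma is_derive_lt (F f : R -> R) (a b : R) :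
  a < b -> (forall t, a <= t <= b -> is_derive F t (f t)) ->
  (forall t, a < t < b -> 0 < f t) -> F a < F b.
Proof.
intros Hab HF Hf; destruct (is_derive_mvt F f a b Hab HF) as [c [Hc Hc2]].
pose proof (Hf c Hc2); nra.
Qed.

(** The integral over the positive half-line is encoded by an antiderivative normalised to vanish at
    $0^+$. Linearity, comparison and integration by parts then become statements about
    antiderivatives. *)
Definition improper_int (f : R -> R) (v : R) : Prop :=
  exists G : R -> R,
    (forall t, 0 < t -> is_derive G t (f t)) /\
    filterlim G (at_right 0) (locally 0) /\
    filterlim G (Rbar_locally p_infty) (locally v).

Lemma improper_int_ext (f g : R -> R) v :
  (forall t, 0 < t -> f t = g t) -> improper_int f v -> improper_int g v.
Proof.
intros E [G [H1 H2]]; exists G; split; [|exact H2].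
intros t Ht; rewrite <- E by exact Ht; auto.
Qed.

Lemma improper_int_lin (f g : R -> R) (a b v w : R) :
  improper_int f v -> improper_int g w ->
  improper_int (fun t => a * f t + b * g t) (a * v + b * w).
Proof.
intros [F [F1 [F2 F3]]] [G [G1 [G2 G3]]].
assert (HL : forall (T : (R -> Prop) -> Prop) {FT : Filter T} x y,
  filterlim F T (locally x) -> filterlim G T (locally y) ->
  filterlim (fun t => a * F t + b * G t) T (locally (a * x + b * y))).
{ intros T FT x y Hx Hy.
  apply (filterlim_comp_2 (G := locally (a * x)) (H := locally (b * y))
           (fun t => a * F t) (fun t => b * G t) Rplus).
  - eapply filterlim_comp; [exact Hx|apply (filterlim_scal_r a x)].
  - eapply filterlim_comp; [exact Hy|apply (filterlim_scal_r b y)].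
  - apply (filterlim_plus (a * x) (b * y)). }
exists (fun t => a * F t + b * G t); split; [|split].
- intros t Ht; apply (is_derive_plus (fun t => a * F t) (fun t => b * G t)).
  + apply (is_derive_scal F); auto.
  + apply (is_derive_scal G); auto.
- replace 0 with (a * 0 + b * 0) at 2 by ring; apply HL; auto; typeclasses eauto.
- apply HL; auto; typeclasses eauto.
Qed.

Lemma at_right_lt (a b : R) : a < b -> at_right a (fun s => a < s < b).
Proof.
intros H; exists (mkposreal (b - a) ltac:(lra)); intros s Hs Hs0.
revert Hs; unfold ball; simpl; unfold AbsRing_ball, abs, minus, plus, opp; simpl.
intros Hs; apply Rabs_def2 in Hs; lra.
Qed.

Lemma p_infty_gt (a : R) : Rbar_locally p_infty (fun s => a < s).
Proof. exists a; auto. Qed.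

Lemma monotone_range (G : R -> R) v :
  (forall s t, 0 < s -> s <= t -> G s <= G t) ->
  filterlim G (at_right 0) (locally 0) ->
  filterlim G (Rbar_locally p_infty) (locally v) ->
  forall t, 0 < t -> 0 <= G t <= v.
Proof.
intros Hm H0 H1 t Ht; split.
- apply (filterlim_le (F := at_right 0) G (fun _ => G t) 0 (G t)).
  + generalize (at_right_lt 0 t Ht); apply filter_imp; intros s Hs; apply Hm; lra.
  + exact H0.
  + apply filterlim_const.
- apply (filterlim_le (F := Rbar_locally p_infty) (fun _ => G t) G (G t) v).
  + generalize (p_infty_gt t); apply filter_imp; intros s Hs; apply Hm; lra.
  + apply filterlim_const.
  + exact H1.
Qed.

Lemma improper_int_pos (f : R -> R) v :
  improper_int f v -> (forall t, 0 < t -> 0 < f t) -> 0 < v.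
Proof.
intros [G [H1 [H2 H3]]] Hf.
assert (Hm : forall s t, 0 < s -> s <= t -> G s <= G t).
{ intros s t Hs Hst; apply is_derive_le with f; [exact Hst| |].
  - intros u Hu; apply H1; lra.
  - intros u Hu; apply Rlt_le, Hf; lra. }
pose proof (monotone_range G v Hm H2 H3 1 ltac:(lra)).
pose proof (monotone_range G v Hm H2 H3 2 ltac:(lra)).
assert (G 1 < G 2); [|lra].
apply is_derive_lt with f; [lra| |]; intros u Hu; [apply H1|apply Hf]; lra.
Qed.

(** The antiderivative of $g - f$ is nondecreasing, so it stays between its limits $0$ and $w -
    v$. *)
Lemma improper_int_le (f g : R -> R) v w :
  improper_int f v -> improper_int g w ->
  (forall t, 0 < t -> f t <= g t) -> v <= w.
Proof.
intros Hf Hg Hfg.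
destruct (improper_int_lin g f 1 (-1) w v Hg Hf) as [G [H1 [H2 H3]]].
enough (0 <= G 1 <= 1 * w + -1 * v) by lra.
apply monotone_range; auto; [|lra].
intros s t Hs Hst; eapply is_derive_le; [exact Hst| |].
- intros u Hu; apply H1; lra.
- intros u Hu; simpl; pose proof (Hfg u ltac:(lra)); lra.
Qed.

(** Bridge to the definition of [Gamma]: on a compact subinterval the fundamental theorem gives
    [G b - G a], which tends to $v - 0$. *)
Lemma improper_int_RInt_gen (f : R -> R) v :
  (forall t, 0 < t -> continuous f t) -> improper_int f v ->
  RInt_gen f (at_right 0) (Rbar_locally p_infty) = v.
Proof.
intros Hc [G [H1 [H2 H3]]].
apply is_RInt_gen_unique.
intros P HP.
assert (HG : filterlim (fun ab : R * R => minus (G (snd ab)) (G (fst ab)))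
   (filter_prod (at_right 0) (Rbar_locally p_infty)) (locally v)).
{ replace v with (minus v 0) by (unfold minus, plus, opp; simpl; ring).
  apply (filterlim_comp_2 (G := locally v) (H := locally (opp 0))
           (fun ab : R * R => G (snd ab)) (fun ab : R * R => opp (G (fst ab))) plus).
  - eapply filterlim_comp; [apply filterlim_snd|exact H3].
  - eapply filterlim_comp; [|apply (filterlim_opp (V := R_NormedModule) 0)].
    eapply filterlim_comp; [apply filterlim_fst|exact H2].
  - apply (filterlim_plus (V := R_NormedModule) v (opp 0)). }
specialize (HG P HP); unfold filtermapi; unfold filtermap in HG.
assert (Hpos : filter_prod (at_right 0) (Rbar_locally p_infty)
   (fun ab : R * R => 0 < fst ab /\ fst ab < 1 /\ 1 < snd ab)).
{ exists (fun s => 0 < s < 1) (fun t => 1 < t).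
  - apply at_right_lt; lra.
  - apply p_infty_gt.
  - simpl; intros; lra. }
generalize (filter_and _ _ HG Hpos); apply filter_imp.
intros [a b] [HPab Hab]; simpl in *.
exists (minus (G b) (G a)); split; [|exact HPab].
apply (is_RInt_derive G f); rewrite Rmin_left, Rmax_right by lra; intros t Ht.
- apply H1; lra.
- apply Hc; lra.
Qed.

Lemma monotone_lim_p_infty (F : R -> R) (M : R) :
  (forall s t, 0 < s -> s <= t -> F s <= F t) ->
  (forall t, 0 < t -> F t <= M) ->
  exists l, filterlim F (Rbar_locally p_infty) (locally l).
Proof.
intros Hm Hb.
destruct (completeness (fun y => exists t, 0 < t /\ y = F t)) as [l [Hl1 Hl2]].
- exists M; intros y [t [Ht ->]]; auto.
- exists (F 1), 1; split; [lra|reflexivity].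
- exists l; apply filterlim_locally; intros eps.
  assert (Hex : exists t, 0 < t /\ l - eps < F t).
  { apply Classical_Prop.NNPP; intros Hn.
    assert (l <= l - eps); [|pose proof (cond_pos eps); lra].
    apply Hl2; intros y [t [Ht ->]].
    destruct (Rle_lt_dec (F t) (l - eps)) as [H|H]; [exact H|].
    exfalso; apply Hn; exists t; auto. }
  destruct Hex as [t [Ht Hlt]]; exists t; intros s Hs.
  assert (F t <= F s) by (apply Hm; lra).
  assert (F s <= l) by (apply Hl1; exists s; split; [lra|reflexivity]).
  unfold ball; simpl; unfold AbsRing_ball, abs, minus, plus, opp; simpl.
  apply Rabs_def1; pose proof (cond_pos eps); lra.
Qed.

(** The substitution $t \mapsto 1/t$ with a change of sign reduces this to the limit at infinity. *)
Lemma monotone_lim_at_right_0 (F : R -> R) (M : R) :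
  (forall s t, 0 < s -> s <= t -> F s <= F t) ->
  (forall t, 0 < t -> M <= F t) ->
  exists l, filterlim F (at_right 0) (locally l).
Proof.
intros Hm Hb.
destruct (monotone_lim_p_infty (fun t => - F (/ t)) (- M)) as [l Hl].
- intros s t Hs Hst; apply Ropp_le_contravar, Hm.
  + apply Rinv_0_lt_compat; lra.
  + apply Rinv_le_contravar; lra.
- intros t Ht; apply Ropp_le_contravar, Hb, Rinv_0_lt_compat, Ht.
- exists (- l).
  apply filterlim_ext_loc with (fun t => - - F (/ / t)).
  + generalize (at_right_lt 0 1 ltac:(lra)); apply filter_imp; intros t Ht.
    rewrite Rinv_inv; ring.
  + eapply filterlim_comp; [|apply (filterlim_opp (V := R_NormedModule) l)].
    apply (filterlim_comp _ _ _ Rinv (fun t => - F (/ t)) _ (Rbar_locally p_infty)).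
    * apply filterlim_Rinv_0_right.
    * exact Hl.
Qed.

(** Both [F] and [G - F] are nondecreasing, so the increments of [F] are bounded by those of [G].
    Hence [F] has finite limits at both ends, and subtracting its limit at $0^+$ normalises it. *)
Lemma improper_int_dominated (f g : R -> R) w :
  (forall t, 0 < t -> continuous f t) ->
  (forall t, 0 < t -> 0 <= f t <= g t) -> improper_int g w ->
  exists v, improper_int f v.
Proof.
intros Hc Hfg [G [G1 [G2 G3]]].
set (F := fun t => RInt f 1 t).
assert (HF : forall t, 0 < t -> is_derive F t (f t)).
{ intros t Ht; apply is_derive_RInt with 1; [|auto].
  exists (mkposreal t Ht); intros s Hs.
  revert Hs; unfold ball; simpl; unfold AbsRing_ball, abs, minus, plus, opp; simpl.
  intros Hs; apply Rabs_def2 in Hs.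
  apply (RInt_correct (V := R_CompleteNormedModule)), ex_RInt_continuous.
  intros z Hz; apply Hc.
  apply Rlt_le_trans with (Rmin 1 s); [apply Rmin_pos; lra|apply Hz]. }
assert (HFm : forall s t, 0 < s -> s <= t -> F s <= F t).
{ intros s t Hs Hst; apply is_derive_le with f; [exact Hst| |].
  - intros u Hu; apply HF; lra.
  - intros u Hu; apply Hfg; lra. }
assert (HGm : forall s t, 0 < s -> s <= t -> G s <= G t).
{ intros s t Hs Hst; apply is_derive_le with g; [exact Hst| |].
  - intros u Hu; apply G1; lra.
  - intros u Hu; pose proof (Hfg u ltac:(lra)); lra. }
assert (HGF : forall s t, 0 < s -> s <= t -> G s - F s <= G t - F t).
{ intros s t Hs Hst.
  apply (is_derive_le (fun t => G t - F t) (fun t => g t - f t)); [exact Hst| |].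
  - intros u Hu; apply (is_derive_minus G F); [apply G1|apply HF]; lra.
  - intros u Hu; pose proof (Hfg u ltac:(lra)); lra. }
assert (HF1 : F 1 = 0) by exact (RInt_point 1 f).
pose proof (monotone_range G w HGm G2 G3) as HGr.
destruct (monotone_lim_p_infty F w HFm) as [l1 Hl1].
{ intros t Ht; pose proof (HGr t Ht); pose proof (HGr 1 Rlt_0_1).
  destruct (Rle_lt_dec 1 t) as [H1|H1].
  - pose proof (HGF 1 t Rlt_0_1 H1); lra.
  - pose proof (HFm t 1 Ht ltac:(lra)); lra. }
destruct (monotone_lim_at_right_0 F (- w) HFm) as [l0 Hl0].
{ intros t Ht; pose proof (HGr t Ht); pose proof (HGr 1 Rlt_0_1).
  destruct (Rle_lt_dec 1 t) as [H1|H1].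
  - pose proof (HFm 1 t Rlt_0_1 H1); lra.
  - pose proof (HGF t 1 Ht ltac:(lra)); lra. }
exists (l1 - l0), (fun t => F t - l0); split; [|split].
- intros t Ht; replace (f t) with (f t - 0) by ring.
  apply (is_derive_minus F (fun _ => l0)); [auto|apply @is_derive_const].
- replace 0 with (l0 - l0) at 2 by ring.
  apply (filterlim_comp _ _ _ F (fun y => y - l0) _ (locally l0)); [exact Hl0|].
  apply (continuous_minus (fun y : R => y) (fun _ => l0));
    [apply continuous_id|apply continuous_const].
- apply (filterlim_comp _ _ _ F (fun y => y - l0) _ (locally l1)); [exact Hl1|].
  apply (continuous_minus (fun y : R => y) (fun _ => l0));
    [apply continuous_id|apply continuous_const].
Qed.

(** * Euler's integral *)

(** For $s > -1$ and $a > 0$ this is the integrand of $\Gamma(s+1)/a^{s+1}$. *)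
Definition power_exp (s a t : R) : R := Rpower t s * exp (- a * t).

Lemma power_exp_pos s a t : 0 < power_exp s a t.
Proof. apply Rmult_lt_0_compat; apply exp_pos. Qed.

Lemma Rpower_minus_1 t s : 0 < t -> Rpower t (s - 1) = Rpower t s / t.
Proof.
intros Ht; unfold Rminus; rewrite Rpower_plus, Rpower_Ropp, Rpower_1 by exact Ht.
reflexivity.
Qed.

Lemma is_derive_power_exp s a t : 0 < t ->
  is_derive (power_exp s a) t (s * power_exp (s - 1) a t - a * power_exp s a t).
Proof.
intros Ht; unfold power_exp; rewrite Rpower_minus_1 by exact Ht.
unfold Rpower; auto_derive; [exact Ht|field; lra].
Qed.

Lemma continuous_power_exp s a t : 0 < t -> continuous (power_exp s a) t.
Proof.
intros Ht; apply (ex_derive_continuous (power_exp s a)).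
eexists; now apply is_derive_power_exp.
Qed.

Lemma exp_le_mono x y : x <= y -> exp x <= exp y.
Proof. intros [H | ->]; [now apply Rlt_le, exp_increasing|apply Rle_refl]. Qed.

Lemma ln_le_minus_1 x : 0 < x -> ln x <= x - 1.
Proof. intros Hx; pose proof (exp_ineq1_le (ln x)); rewrite exp_ln in *; lra. Qed.

(** Half of the exponential absorbs the power, by $\ln(ct) \le ct - 1$ for a small enough $c$. *)
Lemma power_exp_decay s a : 0 <= s -> 0 < a ->
  exists K, forall t, 0 < t -> power_exp s a t <= K * exp (- (a / 2) * t).
Proof.
(* This choice gives $sc \le a/2$; the denominator has $s + 1$ so that $s = 0$ is allowed. *)
intros Hs Ha; set (c := a / (2 * (s + 1))).
assert (Hc : 0 < c) by (apply Rdiv_lt_0_compat; lra).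
exists (exp (s * (- 1 - ln c))); intros t Ht.
unfold power_exp, Rpower; rewrite <- !exp_plus.
apply exp_le_mono.
assert (0 < c * t) by (apply Rmult_lt_0_compat; lra).
pose proof (ln_le_minus_1 (c * t) H) as Hl; rewrite ln_mult in Hl by lra.
assert (s * ln t <= s * (c * t - 1 - ln c)) by (apply Rmult_le_compat_l; lra).
assert (s * c <= a / 2); [|nra].
unfold c; apply Rmult_le_reg_r with (2 * (s + 1)); [lra|].
replace (s * (a / (2 * (s + 1))) * (2 * (s + 1))) with (s * a) by (field; lra).
nra.
Qed.

Lemma exp_decay_lim a : 0 < a ->
  filterlim (fun t => exp (- a * t)) (Rbar_locally p_infty) (locally 0).
Proof.
intros Ha; apply filterlim_comp with (Rbar_locally m_infty);
  [|exact is_lim_exp_m].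
intros P [M HM]; exists (- M / a); intros t Ht; apply HM.
apply Rmult_lt_compat_r with (r := a) in Ht; [|lra].
replace (- M / a * a) with (- M) in Ht by (field; lra); lra.
Qed.

Lemma power_exp_lim_p_infty s a : 0 <= s -> 0 < a ->
  filterlim (power_exp s a) (Rbar_locally p_infty) (locally 0).
Proof.
intros Hs Ha; destruct (power_exp_decay s a Hs Ha) as [K HK].
apply filterlim_le_le with (f := fun _ : R => 0) (h := fun t => K * exp (- (a / 2) * t))
  (l := Finite 0).
- generalize (p_infty_gt 0); apply filter_imp; intros t Ht.
  pose proof (power_exp_pos s a t); auto with real.
- apply filterlim_const.
- change (Rbar_locally 0) with (locally 0).
  replace 0 with (K * 0) by ring.
  eapply filterlim_comp; [apply exp_decay_lim; lra|].
  apply (filterlim_scal_r K 0).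
Qed.

Lemma power_exp_lim_0 s a : 0 < s -> 0 < a ->
  filterlim (power_exp s a) (at_right 0) (locally 0).
Proof.
intros Hs Ha.
apply filterlim_le_le with (f := fun _ : R => 0) (h := fun t => exp (s * ln t))
  (l := Finite 0).
- generalize (at_right_lt 0 1 Rlt_0_1); apply filter_imp; intros t Ht.
  split; [apply Rlt_le, power_exp_pos|].
  unfold power_exp, Rpower; rewrite <- exp_plus; apply exp_le_mono.
  assert (0 < a * t) by (apply Rmult_lt_0_compat; lra); lra.
- apply filterlim_const.
- apply filterlim_comp with (Rbar_locally m_infty); [|exact is_lim_exp_m].
  eapply filterlim_comp; [exact is_lim_ln_0|].
  intros P [M HM]; exists (M / s); intros t Ht; apply HM.
  apply Rmult_lt_compat_r with (r := s) in Ht; [|lra].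
  replace (M / s * s) with M in Ht by (field; lra); lra.
Qed.

Lemma improper_int_exp a : 0 < a -> improper_int (power_exp 0 a) (/ a).
Proof.
intros Ha.
apply improper_int_ext with (fun t => exp (- a * t)).
{ intros t Ht; unfold power_exp; rewrite Rpower_O by exact Ht; ring. }
assert (HL : forall (T : (R -> Prop) -> Prop) {FT : Filter T} x,
  filterlim (fun t => exp (- a * t)) T (locally x) ->
  filterlim (fun t => (1 - exp (- a * t)) / a) T (locally ((1 - x) / a))).
{ intros T FT x Hx.
  apply (filterlim_comp _ _ _ (fun t => exp (- a * t)) (fun y => (1 - y) / a)
          _ (locally x)); [exact Hx|].
  apply (ex_derive_continuous (fun y => (1 - y) / a)); auto_derive; trivial. }
exists (fun t => (1 - exp (- a * t)) / a); split; [|split].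
- intros t Ht; auto_derive; [trivial|field; lra].
- replace 0 with ((1 - 1) / a) at 2 by (field; lra).
  apply HL; [typeclasses eauto|].
  apply (filterlim_filter_le_1 (F := locally 0) (G := at_right 0)).
  + intros P HP; unfold at_right, within; generalize HP; apply filter_imp; auto.
  + replace 1 with (exp (- a * 0)) by (rewrite Rmult_0_r; apply exp_0).
    apply (ex_derive_continuous (fun t => exp (- a * t))); auto_derive; trivial.
- replace (/ a) with ((1 - 0) / a) by (field; lra).
  apply HL; [typeclasses eauto|]; now apply exp_decay_lim.
Qed.

(** Integration by parts: the integrand is the derivative of [power_exp s a], whose boundary values
    both vanish. *)
Lemma improper_int_parts s a : 0 < s -> 0 < a ->
  improper_int (fun t => s * power_exp (s - 1) a t - a * power_exp s a t) 0.
Proof.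
intros Hs Ha; exists (power_exp s a); split; [|split].
- intros t Ht; now apply is_derive_power_exp.
- now apply power_exp_lim_0.
- apply power_exp_lim_p_infty; lra.
Qed.

Lemma improper_int_power_succ s a v : 0 < s -> 0 < a ->
  improper_int (power_exp (s - 1) a) v -> improper_int (power_exp s a) (s * v / a).
Proof.
intros Hs Ha Hv.
apply improper_int_ext with (fun t => s / a * power_exp (s - 1) a t +
  (- / a) * (s * power_exp (s - 1) a t - a * power_exp s a t)).
- intros t Ht; field; lra.
- replace (s * v / a) with (s / a * v + - / a * 0) by (field; lra).
  apply improper_int_lin; [exact Hv|now apply improper_int_parts].
Qed.

(** The downward direction reaches exponents in $(-1, 0)$, where the integrand is unbounded near $0$
    and domination by an exponential fails. *)
Lemma improper_int_power_pred s a v : 0 < s -> 0 < a ->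
  improper_int (power_exp s a) v -> improper_int (power_exp (s - 1) a) (a * v / s).
Proof.
intros Hs Ha Hv.
apply improper_int_ext with (fun t => a / s * power_exp s a t +
  / s * (s * power_exp (s - 1) a t - a * power_exp s a t)).
- intros t Ht; field; lra.
- replace (a * v / s) with (a / s * v + / s * 0) by (field; lra).
  apply improper_int_lin; [exact Hv|now apply improper_int_parts].
Qed.

(** Also $(-1)^k$ times the $k$-th derivative of $1/a$, so differentiation merely raises the
    index. *)
Definition pow_laplace (k : nat) (a : R) : R := INR (fact k) / a ^ S k.

Lemma improper_int_pow_laplace k a : 0 < a ->
  improper_int (fun t => t ^ k * exp (- a * t)) (pow_laplace k a).
Proof.
intros Ha; apply improper_int_ext with (power_exp (INR k) a).
{ intros t Ht; unfold power_exp; rewrite Rpower_pow by exact Ht; reflexivity. }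
induction k as [|k IH].
- replace (pow_laplace 0 a) with (/ a) by (unfold pow_laplace; simpl; field; lra).
  now apply improper_int_exp.
- replace (pow_laplace (S k) a) with (INR (S k) * pow_laplace k a / a).
  + apply improper_int_power_succ; [apply lt_0_INR; lia|exact Ha|].
    replace (INR (S k) - 1) with (INR k) by (rewrite S_INR; ring); exact IH.
  + unfold pow_laplace; change (fact (S k)) with (S k * fact k)%nat.
    rewrite mult_INR; simpl pow; field; split; [apply pow_nonzero|]; lra.
Qed.

(** The integral with exponent $x$ converges by domination; integration by parts then lowers the
    exponent to $x - 1$. *)
Lemma Gamma_improper x : 0 < x -> improper_int (power_exp (x - 1) 1) (Gamma x).
Proof.
intros Hx.
assert (Hbig : forall s, 0 <= s -> exists v, improper_int (power_exp s 1) v).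
{ intros s Hs; destruct (power_exp_decay s 1 Hs Rlt_0_1) as [K HK].
  (* The summand with coefficient 0 only gives the bound the shape required by
     [improper_int_lin]. *)
  apply improper_int_dominated with
    (fun t => K * power_exp 0 (1 / 2) t + 0 * power_exp 0 (1 / 2) t)
    (K * / (1 / 2) + 0 * / (1 / 2)).
  - intros t Ht; now apply continuous_power_exp.
  - intros t Ht; split; [apply Rlt_le, power_exp_pos|].
    eapply Rle_trans; [apply HK, Ht|].
    unfold power_exp; rewrite Rpower_O by exact Ht; lra.
  - apply improper_int_lin; apply improper_int_exp; lra. }
destruct (Hbig x ltac:(lra)) as [v Hv].
apply improper_int_power_pred in Hv; [|lra|lra].
replace (Gamma x) with (1 * v / x); [exact Hv|symmetry].
unfold Gamma; apply improper_int_RInt_gen.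
- intros t Ht; apply continuous_ext with (power_exp (x - 1) 1).
  + intros u; unfold power_exp; do 2 f_equal; ring.
  + now apply continuous_power_exp.
- generalize Hv; apply improper_int_ext.
  intros t Ht; unfold power_exp; do 2 f_equal; ring.
Qed.

Lemma improper_int_unique (f : R -> R) v w :
  improper_int f v -> improper_int f w -> v = w.
Proof.
intros Hv Hw; apply Rle_antisym; eapply improper_int_le; eauto; intros; lra.
Qed.

Lemma Gamma_pos x : 0 < x -> 0 < Gamma x.
Proof.
intros Hx; eapply improper_int_pos; [now apply Gamma_improper|].
intros t Ht; apply power_exp_pos.
Qed.

Lemma Gamma_succ x : 0 < x -> Gamma (x + 1) = x * Gamma x.
Proof.
intros Hx; apply (improper_int_unique (power_exp x 1)).
- replace x with (x + 1 - 1) at 1 by ring; apply Gamma_improper; lra.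
- replace (x * Gamma x) with (x * Gamma x / 1) by field.
  apply improper_int_power_succ; [lra|lra|now apply Gamma_improper].
Qed.

Lemma Gamma_1 : Gamma 1 = 1.
Proof.
apply (improper_int_unique (power_exp 0 1)).
- replace 0 with (1 - 1) by ring; apply Gamma_improper; lra.
- rewrite <- Rinv_1 at 2; apply improper_int_exp; lra.
Qed.

(** Convexity of the exponential: its tangent at $sw$, where $w = \ln u$, lies below it at $w$ and
    at $0$. Weighting these two bounds by $s$ and $1 - s$ cancels the linear terms. *)
Lemma Rpower_le_chord u s : 0 < u -> 0 <= s <= 1 -> Rpower u s <= (1 - s) + s * u.
Proof.
intros Hu Hs; unfold Rpower; set (w := ln u).
replace u with (exp w) by (apply exp_ln; exact Hu).
pose proof (exp_ineq1_le ((1 - s) * w)) as H1.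
pose proof (exp_ineq1_le (- (s * w))) as H2.
pose proof (exp_pos (s * w)) as Hp.
assert (E1 : exp w = exp (s * w) * exp ((1 - s) * w))
  by (rewrite <- exp_plus; f_equal; ring).
assert (E2 : 1 = exp (s * w) * exp (- (s * w)))
  by (rewrite <- exp_plus, Rplus_opp_r, exp_0; reflexivity).
assert (exp (s * w) * (1 + (1 - s) * w) <= exp w)
  by (rewrite E1; apply Rmult_le_compat_l; lra).
assert (exp (s * w) * (1 + - (s * w)) <= 1)
  by (apply Rle_trans with (exp (s * w) * exp (- (s * w)));
      [apply Rmult_le_compat_l|]; lra).
assert (s * (exp (s * w) * (1 + (1 - s) * w)) <= s * exp w)
  by (apply Rmult_le_compat_l; lra).
assert ((1 - s) * (exp (s * w) * (1 + - (s * w))) <= (1 - s) * 1)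
  by (apply Rmult_le_compat_l; lra).
lra.
Qed.

(* Wendel's inequality: [u^s <= (1-s) + s u] at [u = t/y] under the integral. *)
Lemma Gamma_shift_le y s : 0 < y -> 0 <= s <= 1 ->
  Gamma (y + s) <= Rpower y s * Gamma y.
Proof.
intros Hy Hs.
replace (Rpower y s * Gamma y)
  with ((1 - s) * Rpower y s * Gamma y + s * Rpower y s / y * Gamma (y + 1))
  by (rewrite Gamma_succ by exact Hy; field; lra).
eapply improper_int_le.
- apply Gamma_improper; lra.
- apply (improper_int_lin (power_exp (y - 1) 1) (power_exp (y + 1 - 1) 1));
    apply Gamma_improper; lra.
- intros t Ht; simpl; unfold power_exp.
  replace (y + s - 1) with ((y - 1) + s) by ring.
  replace (y + 1 - 1) with ((y - 1) + 1) by ring.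
  rewrite !Rpower_plus, Rpower_1 by exact Ht.
  assert (H : Rpower t s <= Rpower y s * ((1 - s) + s * (t / y))).
  { replace (Rpower t s) with (Rpower y s * Rpower (t / y) s).
    - apply Rmult_le_compat_l; [apply Rlt_le, exp_pos|].
      apply Rpower_le_chord; [apply Rdiv_lt_0_compat|]; lra.
    - rewrite Rpower_mult_distr by (try apply Rdiv_lt_0_compat; lra).
      f_equal; field; lra. }
  pose proof (exp_pos (- (1) * t)) as He.
  pose proof (exp_pos ((y - 1) * ln t)) as Hp; change (0 < Rpower t (y - 1)) in Hp.
  replace ((1 - s) * Rpower y s * (Rpower t (y - 1) * exp (- (1) * t)) +
    s * Rpower y s / y * (Rpower t (y - 1) * t * exp (- (1) * t))) with
    (Rpower t (y - 1) * (Rpower y s * ((1 - s) + s * (t / y))) * exp (- (1) * t))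
    by (field; lra).
  apply Rmult_le_compat_r; [lra|]; apply Rmult_le_compat_l; lra.
Qed.

(** * Stirling's formula *)

Definition wallis (n : nat) : R := RInt (fun t => sin t ^ n) 0 (PI / 2).

Lemma continuous_sin_pow n t : continuous (fun t => sin t ^ n) t.
Proof. apply (ex_derive_continuous (fun t => sin t ^ n)); auto_derive; trivial. Qed.

Lemma is_RInt_wallis n : is_RInt (fun t => sin t ^ n) 0 (PI / 2) (wallis n).
Proof.
apply (RInt_correct (V := R_CompleteNormedModule)), ex_RInt_continuous.
intros t _; apply continuous_sin_pow.
Qed.

(** The function $-\cos t \, \sin^{n+1} t$ vanishes at both endpoints, and $\cos^2 t = 1 - \sin^2 t$
    turns its derivative into the difference of the two integrands. *)
Lemma wallis_rec n : INR (n + 2) * wallis (n + 2) = INR (n + 1) * wallis n.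
Proof.
set (F := fun t => - cos t * sin t ^ (n + 1)).
set (f := fun t => INR (n + 2) * sin t ^ (n + 2) - INR (n + 1) * sin t ^ n).
assert (HF : is_RInt f 0 (PI / 2) (minus (F (PI / 2)) (F 0))).
{ apply (is_RInt_derive F f); intros t _.
  - unfold F, f; auto_derive; [trivial|].
    replace (Init.Nat.pred (n + 1)) with n by lia.
    rewrite !pow_add, !plus_INR; simpl.
    pose proof (sin2_cos2 t) as H; unfold Rsqr in H.
    transitivity (sin t ^ n * (sin t * sin t) -
      (INR n + 1) * (cos t * cos t) * sin t ^ n); [ring|].
    replace (cos t * cos t) with (1 - sin t * sin t) by lra; ring.
  - apply (ex_derive_continuous f); unfold f; auto_derive; trivial. }
assert (Hf : is_RInt f 0 (PI / 2)
  (INR (n + 2) * wallis (n + 2) - INR (n + 1) * wallis n)).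
{ apply (is_RInt_minus (V := R_NormedModule));
    apply (is_RInt_scal (V := R_NormedModule)); apply is_RInt_wallis. }
apply (is_RInt_unique (V := R_CompleteNormedModule)) in HF.
apply (is_RInt_unique (V := R_CompleteNormedModule)) in Hf.
rewrite HF in Hf; unfold F, minus, plus, opp in Hf; simpl in Hf.
rewrite cos_PI2, sin_0, !pow_add in Hf; simpl in Hf; lra.
Qed.

Lemma wallis_0 : wallis 0 = PI / 2.
Proof.
unfold wallis; simpl; rewrite RInt_const; unfold scal; simpl; unfold mult; simpl; ring.
Qed.

Lemma wallis_1 : wallis 1 = 1.
Proof.
assert (H : is_RInt (fun t => sin t ^ 1) 0 (PI / 2)
  (minus (- cos (PI / 2)) (- cos 0))).
{ apply (is_RInt_derive (fun t => - cos t)); intros t _.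
  - auto_derive; [trivial|ring].
  - apply continuous_sin_pow. }
apply (is_RInt_unique (V := R_CompleteNormedModule)) in H; unfold wallis; rewrite H, cos_PI2, cos_0.
unfold minus, plus, opp; simpl; ring.
Qed.

(** By the recurrence the product does not depend on $n$. *)
Lemma wallis_mul n : INR (n + 1) * wallis n * wallis (n + 1) = PI / 2.
Proof.
induction n as [|n IH].
- simpl; rewrite wallis_0, wallis_1; field.
- replace (S n + 1)%nat with (n + 2)%nat by lia.
  rewrite Rmult_assoc, (Rmult_comm (wallis (S n))), <- Rmult_assoc, wallis_rec.
  replace (S n) with (n + 1)%nat by lia; exact IH.
Qed.

Lemma sin_range_quadrant t : 0 < t < PI / 2 -> 0 <= sin t <= 1.
Proof.
intros Ht; split; [apply sin_ge_0; lra|apply SIN_bound].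
Qed.

Lemma wallis_pos n : 0 < wallis n.
Proof.
assert (H : 0 <= wallis n).
{ apply RInt_ge_0; [pose proof PI_RGT_0; lra|eexists; apply is_RInt_wallis|].
  intros t Ht; apply pow_le, sin_range_quadrant, Ht. }
destruct H as [H|H]; [exact H|].
pose proof (wallis_mul n); pose proof PI_RGT_0; rewrite <- H in *; lra.
Qed.

Lemma wallis_decr n : wallis (n + 1) <= wallis n.
Proof.
apply RInt_le; [pose proof PI_RGT_0; lra|eexists; apply is_RInt_wallis..|].
intros t Ht; rewrite pow_add; simpl.
pose proof (sin_range_quadrant t Ht); pose proof (pow_le (sin t) n ltac:(lra)); nra.
Qed.

(** Since [wallis] is nonincreasing, its square at $2n$ lies between its products with the two
    neighbouring values, which [wallis_mul] evaluates. *)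
Lemma wallis_sqr_bounds n : (1 <= n)%nat ->
  PI / 2 * (INR n / (INR n + / 2)) <= wallis (2 * n) ^ 2 * INR (2 * n) <= PI / 2.
Proof.
intros Hn; pose proof (wallis_pos (2 * n)) as Hp.
pose proof (lt_0_INR n ltac:(lia)) as Hn0.
split.
- rewrite <- (wallis_mul (2 * n)).
  pose proof (wallis_decr (2 * n)) as Hd.
  replace (INR (2 * n + 1)) with (2 * (INR n + / 2))
    by (rewrite plus_INR, mult_INR; simpl; lra).
  replace (INR (2 * n)) with (2 * INR n) by (rewrite mult_INR; simpl; lra).
  replace (2 * (INR n + / 2) * wallis (2 * n) * wallis (2 * n + 1) *
    (INR n / (INR n + / 2))) with
    (2 * INR n * wallis (2 * n) * wallis (2 * n + 1)) by (field; lra).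
  replace (wallis (2 * n) ^ 2 * (2 * INR n)) with
    (2 * INR n * wallis (2 * n) * wallis (2 * n)) by ring.
  apply Rmult_le_compat_l; [apply Rmult_le_pos; lra|exact Hd].
- rewrite <- (wallis_mul (2 * n - 1)).
  pose proof (wallis_decr (2 * n - 1)) as Hd.
  replace (2 * n - 1 + 1)%nat with (2 * n)%nat in * by lia.
  pose proof (lt_0_INR (2 * n) ltac:(lia)) as H2n.
  replace (wallis (2 * n) ^ 2 * INR (2 * n)) with
    (INR (2 * n) * wallis (2 * n) * wallis (2 * n)) by ring.
  apply Rmult_le_compat_r; [lra|].
  apply Rmult_le_compat_l; lra.
Qed.

Lemma is_lim_inv_shift a c : is_lim (fun u => c / (u + a)) p_infty 0.
Proof.
replace (Finite 0) with (Rbar_mult c (Rbar_inv p_infty))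
  by (simpl; f_equal; ring).
apply (is_lim_scal_l (fun u => / (u + a)) c p_infty).
apply is_lim_inv; [|discriminate].
apply (is_lim_plus (fun u => u) (fun _ => a) p_infty p_infty a);
  [apply is_lim_id|apply is_lim_const|reflexivity].
Qed.

Lemma is_lim_affine_inv a b c : is_lim (fun u => b + c / (u + a)) p_infty b.
Proof.
replace (Finite b) with (Finite (b + 0)) by (f_equal; ring).
apply is_lim_plus'; [apply is_lim_const|apply is_lim_inv_shift].
Qed.

Lemma ln_quotient_bounds u b : 0 < u -> 0 <= b ->
  b / (u + b) <= ln (u + b) - ln u <= b / u.
Proof.
intros Hu Hb; rewrite <- ln_div by lra; split.
- replace ((u + b) / u) with (/ (u / (u + b))) by (field; lra).
  assert (H : 0 < u / (u + b)) by (apply Rdiv_lt_0_compat; lra).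
  rewrite ln_Rinv by exact H.
  pose proof (ln_le_minus_1 _ H).
  replace (b / (u + b)) with (- (u / (u + b) - 1)) by (field; lra); lra.
- assert (H : 0 < (u + b) / u) by (apply Rdiv_lt_0_compat; lra).
  pose proof (ln_le_minus_1 _ H).
  replace (b / u) with ((u + b) / u - 1) by (field; lra); lra.
Qed.

(** Used twice: for non-integer shifts in Stirling's formula, and to compare $\ln x$ with $\ln(x -
    \lambda)$. *)
Lemma is_lim_ln_quotient a b : 0 <= b ->
  is_lim (fun u => (u + a) * (ln (u + b) - ln u)) p_infty b.
Proof.
intros Hb.
apply is_lim_le_le_loc with
  (fun u => b + b * (a - b) / (u + b)) (fun u => b + b * a / (u + 0)).
(* Beyond $|a|$ both $u$ and $u + a$ are positive, so the bounds may be multiplied by $u + a$. *)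
- exists (Rabs a); intros u Hu; pose proof (Rle_abs (- a)); rewrite Rabs_Ropp in *.
  pose proof (Rabs_pos a).
  destruct (ln_quotient_bounds u b ltac:(lra) Hb) as [H1 H2].
  replace (b + b * (a - b) / (u + b)) with ((u + a) * (b / (u + b)))
    by (field; lra).
  replace (b + b * a / (u + 0)) with ((u + a) * (b / u)) by (field; lra).
  split; apply Rmult_le_compat_l; lra.
- apply is_lim_affine_inv.
- apply is_lim_affine_inv.
Qed.

(** Stirling's formula says that this tends to $\ln\sqrt{2\pi}$; the constant is kept inside because
    it is identified only after convergence is known. *)
Definition stirling_err (x : R) : R := ln (Gamma x) - (x - / 2) * ln x + x.

Lemma ln_Gamma_succ x : 0 < x -> ln (Gamma (x + 1)) = ln x + ln (Gamma x).
Proof.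
intros Hx; rewrite Gamma_succ by exact Hx.
apply ln_mult; [exact Hx|now apply Gamma_pos].
Qed.

(** Wendel's inequality from $y$ to $y + s$ gives the upper bound; from $y + s$ to $y + 1$, with the
    functional equation, it gives the lower one. *)
Lemma stirling_err_shift y s : 0 < y -> 0 <= s <= 1 ->
  s - (y + / 2) * (ln (y + s) - ln y) <= stirling_err (y + s) - stirling_err y
    <= s - (y + (s - / 2)) * (ln (y + s) - ln y).
Proof.
intros Hy Hs; unfold stirling_err.
assert (HL : forall z r, 0 < z -> 0 <= r <= 1 ->
  ln (Gamma (z + r)) <= r * ln z + ln (Gamma z)).
{ intros z r Hz Hr.
  replace (r * ln z) with (ln (Rpower z r)) by (unfold Rpower; apply ln_exp).
  rewrite <- ln_mult by (try apply exp_pos; now apply Gamma_pos).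
  apply ln_le; [apply Gamma_pos; lra|now apply Gamma_shift_le]. }
pose proof (HL y s Hy Hs) as H1.
pose proof (HL (y + s) (1 - s) ltac:(lra) ltac:(lra)) as H2.
replace (y + s + (1 - s)) with (y + 1) in H2 by ring.
rewrite ln_Gamma_succ in H2 by exact Hy.
split; lra.
Qed.

Lemma stirling_err_shift_lim s : 0 <= s <= 1 ->
  is_lim (fun y => stirling_err (y + s) - stirling_err y) p_infty 0.
Proof.
intros Hs.
assert (HL : forall a,
  is_lim (fun y => s - (y + a) * (ln (y + s) - ln y)) p_infty 0).
{ intros a; replace (Finite 0) with (Finite (s - s)) by (f_equal; ring).
  apply is_lim_minus'; [apply is_lim_const|apply is_lim_ln_quotient; lra]. }
refine (is_lim_le_le_loc _ _ _ _ _ _ (HL (/ 2)) (HL (s - / 2))).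
exists 0; intros y Hy; now apply stirling_err_shift.
Qed.

(** The midpoint rule for $\int_x^{x+1} dt/t$, proved by letting the interval length $h$ grow from
    $0$ to $1$. *)
Lemma ln_succ_lower x : 0 < x -> 2 / (2 * x + 1) <= ln (x + 1) - ln x.
Proof.
intros Hx.
enough (H : ln (x + 0) - 2 * 0 / (2 * x + 0) <= ln (x + 1) - 2 * 1 / (2 * x + 1)).
{ rewrite Rplus_0_r in H; replace (2 * 0 / (2 * x + 0)) with 0 in H by (field; lra).
  replace (2 * 1 / (2 * x + 1)) with (2 / (2 * x + 1)) in H by (field; lra); lra. }
apply (is_derive_le (fun h => ln (x + h) - 2 * h / (2 * x + h))
  (fun h => h ^ 2 / ((x + h) * (2 * x + h) ^ 2))); [lra| |].
- intros h Hh; auto_derive; [repeat split; lra|field; lra].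
- intros h Hh; apply Rmult_le_pos; [apply pow_le; lra|].
  apply Rlt_le, Rinv_0_lt_compat, Rmult_lt_0_compat; [lra|apply pow_lt; lra].
Qed.

(** The trapezoidal rule for the same integral, again by growing the interval. *)
Lemma ln_succ_upper x : 0 < x ->
  ln (x + 1) - ln x <= (2 * x + 1) / (2 * x * (x + 1)).
Proof.
intros Hx.
enough (H : 0 / x + 0 / (x + 0) - 2 * ln (x + 0) <= 1 / x + 1 / (x + 1) - 2 * ln (x + 1)).
{ rewrite Rplus_0_r in H.
  replace ((2 * x + 1) / (2 * x * (x + 1))) with (/ 2 * (1 / x + 1 / (x + 1)))
    by (field; lra).
  unfold Rdiv in *; lra. }
apply (is_derive_le (fun h => h / x + h / (x + h) - 2 * ln (x + h))
  (fun h => h ^ 2 / (x * (x + h) ^ 2))); [lra| |].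
- intros h Hh; auto_derive; [repeat split; lra|field; lra].
- intros h Hh; apply Rmult_le_pos; [apply pow_le; lra|].
  apply Rlt_le, Rinv_0_lt_compat, Rmult_lt_0_compat; [lra|apply pow_lt; lra].
Qed.

(** The upper bound telescopes, so along the integers the sequence is both nonincreasing and bounded
    below. *)
Lemma stirling_err_decr x : 0 < x ->
  0 <= stirling_err x - stirling_err (x + 1) <= / 4 * (/ x - / (x + 1)).
Proof.
intros Hx; unfold stirling_err; rewrite ln_Gamma_succ by exact Hx.
replace (ln (Gamma x) - (x - / 2) * ln x + x -
  (ln x + ln (Gamma x) - (x + 1 - / 2) * ln (x + 1) + (x + 1)))
  with ((x + / 2) * (ln (x + 1) - ln x) - 1) by field.
pose proof (ln_succ_lower x Hx) as H1; pose proof (ln_succ_upper x Hx) as H2.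
apply (Rmult_le_compat_l (x + / 2)) in H1; [|lra].
apply (Rmult_le_compat_l (x + / 2)) in H2; [|lra].
replace ((x + / 2) * (2 / (2 * x + 1))) with 1 in H1 by (field; lra).
replace ((x + / 2) * ((2 * x + 1) / (2 * x * (x + 1))))
  with (1 + / 4 * (/ x - / (x + 1))) in H2 by (field; lra).
lra.
Qed.

Lemma stirling_err_cv :
  exists c : R, is_lim_seq (fun n => stirling_err (INR n)) c.
Proof.
(* The index starts at 1, since the estimates hold only for positive arguments. *)
destruct (ex_finite_lim_seq_decr (fun n => stirling_err (INR (S n)))
  (stirling_err 1 - / 4)) as [c Hc].
- intros n; pose proof (stirling_err_decr (INR (S n)) (lt_0_INR _ (Nat.lt_0_succ n))).
  rewrite (S_INR (S n)); lra.
(* Keeping the telescoped term strengthens the bound enough for the induction. *)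
- intros n; enough (stirling_err 1 - / 4 + / 4 * / INR (S n) <= stirling_err (INR (S n))).
  { pose proof (Rinv_0_lt_compat _ (lt_0_INR _ (Nat.lt_0_succ n))); lra. }
  induction n as [|n IH]; [simpl; lra|].
  pose proof (stirling_err_decr (INR (S n)) (lt_0_INR _ (Nat.lt_0_succ n))).
  rewrite (S_INR (S n)); lra.
- exists c; apply is_lim_seq_incr_1; exact Hc.
Qed.

(** With $m = n + 1$, this is $W_{2m} = \frac{\pi}{2} \frac{(2m)!}{4^m m!^2}$ written through
    $\Gamma(m)$ and $\Gamma(2m)$. *)
Lemma wallis_Gamma n :
  wallis (2 * S n) * Gamma (INR (S n)) ^ 2 * INR (S n) * 4 ^ S n =
  PI * Gamma (INR (2 * S n)).
Proof.
assert (G2 : Gamma 2 = 1).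
{ replace 2 with (1 + 1) by ring; rewrite Gamma_succ, Gamma_1; lra. }
induction n as [|n IH].
- replace (INR (2 * 1)) with 2 by (simpl; ring).
  change (INR 1) with 1; rewrite Gamma_1, G2.
  pose proof (wallis_rec 0) as H; rewrite wallis_0 in H; simpl in *; lra.
- pose proof (wallis_rec (2 * S n)) as Hw.
  replace (2 * S n + 2)%nat with (2 * S (S n))%nat in Hw by lia.
  set (m := S n) in *; assert (Hm : 0 < INR m) by (apply lt_0_INR; lia).
  clearbody m.
  replace (INR (2 * S m)) with (INR (2 * m) + 1 + 1) in *
    by (rewrite !mult_INR, (S_INR m); simpl; ring).
  replace (INR (2 * m + 1)) with (2 * INR m + 1) in *
    by (rewrite plus_INR, mult_INR; simpl; ring).
  replace (INR (2 * m)) with (2 * INR m) in * by (rewrite mult_INR; simpl; ring).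
  rewrite S_INR, !Gamma_succ by lra.
  replace (wallis (2 * S m)) with ((2 * INR m + 1) * wallis (2 * m) / (2 * INR m + 1 + 1))
    by (rewrite <- Hw; field; lra).
  transitivity ((2 * INR m + 1) * (2 * INR m) * (PI * Gamma (2 * INR m))).
  + rewrite <- IH; simpl pow; field; lra.
  + ring.
Qed.

(** If [stirling_err] tends to $c$ along the integers, the left side tends to $2c - c = c$, so the
    Wallis asymptotics on the right determine $c$. *)
Lemma stirling_err_double n : (1 <= n)%nat ->
  2 * stirling_err (INR n) - stirling_err (INR (2 * n)) =
  ln PI - / 2 * ln (wallis (2 * n) ^ 2 * INR (2 * n)).
Proof.
intros Hn; destruct n as [|n]; [lia|].
pose proof (wallis_Gamma n) as H.
set (m := S n) in *; assert (Hm : 0 < INR m) by (apply lt_0_INR; lia).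
  clearbody m.
pose proof (wallis_pos (2 * m)) as Hw.
pose proof (Gamma_pos (INR m) Hm) as Hg1.
replace (INR (2 * m)) with (2 * INR m) in * by (rewrite mult_INR; simpl; ring).
pose proof (Gamma_pos (2 * INR m) ltac:(lra)) as Hg2.
apply (f_equal ln) in H.
pose proof PI_RGT_0.
assert (E4 : ln (4 ^ m) = 2 * INR m * ln 2).
{ rewrite ln_pow by lra; replace 4 with (2 * 2) by ring.
  rewrite ln_mult by lra; ring. }
assert (0 < 4 ^ m) by (apply pow_lt; lra).
assert (0 < Gamma (INR m) ^ 2) by (apply pow_lt; lra).
assert (0 < wallis (2 * m) ^ 2) by (apply pow_lt; lra).
rewrite (ln_mult PI) in H by lra.
rewrite !ln_mult in H by (repeat apply Rmult_lt_0_compat; lra).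
rewrite E4, ln_pow in H by lra.
unfold stirling_err.
rewrite !ln_mult by lra; rewrite ln_pow by lra.
simpl INR in H |- *. lra.
Qed.

Lemma stirling_err_lim_nat :
  is_lim_seq (fun n => stirling_err (INR n)) (ln (sqrt (2 * PI))).
Proof.
destruct stirling_err_cv as [c Hc].
pose proof PI_RGT_0 as HPI.
assert (H2 : is_lim_seq (fun n => 2 * stirling_err (INR n) - stirling_err (INR (2 * n)))
  (2 * c - c)).
{ apply is_lim_seq_minus'.
  - apply (is_lim_seq_scal_l _ 2 c Hc).
  - apply (is_lim_seq_subseq (fun n => stirling_err (INR n)) c (fun n => 2 * n)%nat);
      [|exact Hc].
    apply eventually_subseq; intros n; lia. }
assert (Hw : is_lim_seq (fun n => wallis (2 * n) ^ 2 * INR (2 * n)) (PI / 2)).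
{ apply is_lim_seq_le_le_loc with
    (u := fun n => PI / 2 + (- PI / 4) / (INR n + / 2)) (w := fun _ => PI / 2).
  - exists 1%nat; intros n Hn; destruct (wallis_sqr_bounds n Hn) as [H3 H4].
    split; [|exact H4].
    pose proof (pos_INR n).
    replace (PI / 2 + - PI / 4 / (INR n + / 2)) with
      (PI / 2 * (INR n / (INR n + / 2))) by (field; lra); exact H3.
  - apply (is_lim_comp_seq (fun u => PI / 2 + - PI / 4 / (u + / 2)) INR p_infty).
    + apply is_lim_affine_inv.
    + exists 0%nat; discriminate.
    + apply is_lim_seq_INR.
  - apply is_lim_seq_const. }
assert (H3 : is_lim_seq (fun n => 2 * stirling_err (INR n) - stirling_err (INR (2 * n)))
  (ln PI - / 2 * ln (PI / 2))).
{ apply is_lim_seq_ext_loc with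
    (fun n => ln PI - / 2 * ln (wallis (2 * n) ^ 2 * INR (2 * n))).
  - exists 1%nat; intros n Hn; symmetry; now apply stirling_err_double.
  - apply (is_lim_seq_continuous (fun y => ln PI - / 2 * ln y) _ (PI / 2));
      [|exact Hw].
    apply continuity_pt_filterlim.
    apply (ex_derive_continuous (fun y => ln PI - / 2 * ln y)).
    auto_derive; lra. }
apply is_lim_seq_unique in H2; apply is_lim_seq_unique in H3.
rewrite H2 in H3; injection H3 as E.
replace (ln (sqrt (2 * PI))) with c; [exact Hc|].
assert (E2 : 2 * ln (sqrt (2 * PI)) = ln (2 * PI)).
{ assert (0 < sqrt (2 * PI)) by (apply sqrt_lt_R0; lra).
  rewrite <- (sqrt_sqrt (2 * PI)) at 2 by lra; rewrite ln_mult by lra; ring. }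
rewrite ln_mult in E2 by lra; rewrite ln_div in E by lra; lra.
Qed.

(** For $x \le 1$, compare with the integer sequence by [stirling_err_shift_lim]; larger $x$ are
    reduced by unit steps, which only shift the index. *)
Lemma stirling_err_lim x : 0 <= x ->
  is_lim_seq (fun n => stirling_err (x + INR n)) (ln (sqrt (2 * PI))).
Proof.
intros Hx.
destruct (INR_unbounded x) as [m Hm].
assert (Hm' : x <= INR m + 1) by lra; clear Hm.
revert x Hx Hm'; induction m as [|m IH]; intros x Hx Hm.
- simpl in Hm.
  assert (Hs : is_lim_seq (fun n => (stirling_err (INR n + x) - stirling_err (INR n))
    + stirling_err (INR n)) (0 + ln (sqrt (2 * PI)))).
  { apply is_lim_seq_plus'; [|apply stirling_err_lim_nat].
    apply (is_lim_comp_seq (fun y => stirling_err (y + x) - stirling_err y) INR p_infty).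
    - apply stirling_err_shift_lim; lra.
    - exists 0%nat; discriminate.
    - apply is_lim_seq_INR. }
  rewrite Rplus_0_l in Hs; revert Hs; apply is_lim_seq_ext; intros n.
  rewrite (Rplus_comm x); ring.
- destruct (Rle_lt_dec 1 x) as [H1|H1].
  + pose proof (IH (x - 1) ltac:(lra) ltac:(rewrite S_INR in Hm; lra)) as H.
    apply is_lim_seq_incr_1 in H; revert H; apply is_lim_seq_ext; intros n.
    rewrite S_INR; f_equal; ring.
  + apply IH; [lra|]; pose proof (pos_INR m); lra.
Qed.

(** * Remainders of the Bernoulli generating function *)

Definition bern_gf (x t : R) : R := t * exp (x * t) / (exp t - 1).

(** The terms of index below [n] are removed, so the remainder after the $t^N$ term is
    [bern_rem (S N)]. *)
Fixpoint bern_rem (n : nat) (x t : R) : R :=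
  match n with
  | O => bern_gf x t
  | S m => bern_rem m x t - nbern m x * t ^ m
  end.

Lemma nbern_0_r x : nbern 0 x = 1.
Proof. unfold nbern, PS_mult, expc, recip; simpl; field. Qed.

Lemma nbern_1_r x : nbern 1 x = x - / 2.
Proof.
unfold nbern, PS_mult, expc, recip; simpl; unfold shexp; simpl; field.
Qed.

(** Differentiation in $x$ multiplies the generating function by $t$ and lowers the index of each
    coefficient by one, so one subtracted term fewer remains. *)
Lemma is_derive_bern_rem n x t :
  is_derive (fun x => bern_rem (S n) x t) x (t * bern_rem n x t).
Proof.
induction n as [|n IH].
- apply is_derive_ext with (fun x => bern_gf x t - 1).
  + intros y; simpl; rewrite nbern_0_r; ring.
  + simpl; unfold bern_gf; auto_derive; [trivial|unfold Rdiv; ring].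
- replace (t * bern_rem (S n) x t)
    with (t * bern_rem n x t - nbern n x * t ^ S n) by (simpl; ring).
  apply (is_derive_minus (fun x => bern_rem (S n) x t)
           (fun x => nbern (S n) x * t ^ S n)); [exact IH|].
  apply is_derive_ext with (fun x => t ^ S n * nbern (S n) x);
    [intros y; apply Rmult_comm|rewrite (Rmult_comm (nbern n x))].
  apply (is_derive_scal (nbern (S n))), is_derive_nbern.
Qed.

Lemma exp_m1_pos t : 0 < t -> 0 < exp t - 1.
Proof. intros Ht; pose proof (exp_ineq1_le t); lra. Qed.

(** The generating function differs by $t$ between $x = 1$ and $x = 0$, which the linear terms $\pm
    t/2$ compensate; later coefficients agree at both points. *)
Lemma bern_rem_1_0 n t : 0 < t -> bern_rem (S (S n)) 1 t = bern_rem (S (S n)) 0 t.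
Proof.
intros Ht; induction n as [|n IH].
- simpl; rewrite !nbern_0_r, !nbern_1_r; unfold bern_gf.
  rewrite Rmult_0_l, Rmult_1_l, exp_0.
  field; pose proof (exp_m1_pos t Ht); lra.
- change (bern_rem (S (S n)) 1 t - nbern (S (S n)) 1 * t ^ S (S n) =
    bern_rem (S (S n)) 0 t - nbern (S (S n)) 0 * t ^ S (S n)).
  rewrite IH, nbern_1; reflexivity.
Qed.

(* Twice the part of [bern_rem n] whose parity under [x -> 1 - x] is opposite
   to that of [nbern n]. *)
Definition bern_rem_par (n : nat) (x t : R) : R :=
  bern_rem n x t - (-1) ^ n * bern_rem n (1 - x) t.

Lemma is_derive_bern_rem_par n x t :
  is_derive (fun x => bern_rem_par (S n) x t) x (t * bern_rem_par n x t).
Proof.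
unfold bern_rem_par.
replace (t * (bern_rem n x t - (-1) ^ n * bern_rem n (1 - x) t)) with
  (t * bern_rem n x t - (-1) ^ S n * (-1 * (t * bern_rem n (1 - x) t)))
  by (simpl; ring).
apply (is_derive_minus (fun x => bern_rem (S n) x t)
  (fun x => (-1) ^ S n * bern_rem (S n) (1 - x) t)); [apply is_derive_bern_rem|].
apply (is_derive_scal (fun x => bern_rem (S n) (1 - x) t)).
apply (is_derive_comp (fun y => bern_rem (S n) y t) (fun x => 1 - x));
  [apply is_derive_bern_rem|auto_derive; [trivial|ring]].
Qed.

Lemma bern_rem_par_half k t : bern_rem_par (2 * k) (/ 2) t = 0.
Proof.
unfold bern_rem_par; rewrite pow_1_even; replace (1 - / 2) with (/ 2) by field; ring.
Qed.

Lemma bern_rem_par_0 k t : 0 < t -> bern_rem_par (2 * S k) 0 t = 0.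
Proof.
intros Ht; unfold bern_rem_par; rewrite pow_1_even, Rminus_0_r.
replace (2 * S k)%nat with (S (S (2 * k))) by lia.
rewrite bern_rem_1_0 by exact Ht; ring.
Qed.

(** The hypothesis makes the function of index $2k+1$ strictly monotone on $[0, 1/2]$. The one of
    index $2k+2$ vanishes at both ends, so by Rolle the former has a zero $c$ inside and changes
    sign there. This fixes its sign at $0$ and the sign of the latter in between. *)
Lemma bern_rem_par_step k t : 0 < t ->
  (forall x, 0 < x < / 2 -> 0 < (-1) ^ S k * bern_rem_par (2 * k) x t) ->
  0 < (-1) ^ k * bern_rem_par (2 * k + 1) 0 t /\
  forall x, 0 < x < / 2 -> 0 < (-1) ^ S (S k) * bern_rem_par (2 * S k) x t.
Proof.
intros Ht Hk.
pose proof (is_derive_bern_rem_par (2 * k)) as D1.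
pose proof (is_derive_bern_rem_par (2 * k + 1)) as D2.
replace (S (2 * k)) with (2 * k + 1)%nat in D1 by lia.
replace (S (2 * k + 1)) with (2 * S k)%nat in D2 by lia.
pose proof (bern_rem_par_0 k t Ht) as B0.
pose proof (bern_rem_par_half (S k) t) as B1.
assert (Hm : forall x y, 0 <= x -> x < y -> y <= / 2 ->
  (-1) ^ S k * bern_rem_par (2 * k + 1) x t < (-1) ^ S k * bern_rem_par (2 * k + 1) y t).
{ intros x y Hx Hxy Hy.
  apply (is_derive_lt (fun z => (-1) ^ S k * bern_rem_par (2 * k + 1) z t)
    (fun z => (-1) ^ S k * (t * bern_rem_par (2 * k) z t))); [exact Hxy| |].
  - intros z Hz; apply (is_derive_scal (fun z => bern_rem_par (2 * k + 1) z t)), D1.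
  - intros z Hz; pose proof (Hk z ltac:(lra)).
    replace ((-1) ^ S k * (t * bern_rem_par (2 * k) z t))
      with (t * ((-1) ^ S k * bern_rem_par (2 * k) z t)) by ring.
    apply Rmult_lt_0_compat; lra. }
destruct (is_derive_mvt (fun z => bern_rem_par (2 * S k) z t)
  (fun z => t * bern_rem_par (2 * k + 1) z t) 0 (/ 2) ltac:(lra)
  ltac:(intros; apply D2)) as [c [Hc Hc2]].
cbv beta in Hc; rewrite B0, B1 in Hc.
assert (Hc0 : bern_rem_par (2 * k + 1) c t = 0) by nra.
clear Hc.
split.
- pose proof (Hm 0 c ltac:(lra) ltac:(lra) ltac:(lra)) as H.
  rewrite Hc0 in H; simpl in H |- *; lra.
- intros x Hx.
  change ((-1) ^ S (S k)) with (-1 * (-1) ^ S k).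
  (* Integrate from the endpoint on the same side of $c$ as $x$, where the function vanishes and its
     derivative keeps one sign on the way. *)
  destruct (Rle_lt_dec x c) as [Hxc|Hxc].
  + destruct (is_derive_mvt (fun z => bern_rem_par (2 * S k) z t)
      (fun z => t * bern_rem_par (2 * k + 1) z t) 0 x ltac:(lra)
      ltac:(intros; apply D2)) as [d [Hd Hd2]].
    cbv beta in Hd; rewrite B0 in Hd.
    pose proof (Hm d c ltac:(lra) ltac:(lra) ltac:(lra)) as H; rewrite Hc0 in H.
    replace (bern_rem_par (2 * S k) x t)
      with (t * bern_rem_par (2 * k + 1) d t * x) by lra.
    replace (-1 * (-1) ^ S k * (t * bern_rem_par (2 * k + 1) d t * x))
      with (t * x * (- ((-1) ^ S k * bern_rem_par (2 * k + 1) d t))) by ring.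
    apply Rmult_lt_0_compat; [apply Rmult_lt_0_compat; lra|lra].
  + destruct (is_derive_mvt (fun z => bern_rem_par (2 * S k) z t)
      (fun z => t * bern_rem_par (2 * k + 1) z t) x (/ 2) ltac:(lra)
      ltac:(intros; apply D2)) as [d [Hd Hd2]].
    cbv beta in Hd; rewrite B1 in Hd.
    pose proof (Hm c d ltac:(lra) ltac:(lra) ltac:(lra)) as H; rewrite Hc0 in H.
    replace (bern_rem_par (2 * S k) x t)
      with (- (t * bern_rem_par (2 * k + 1) d t * (/ 2 - x))) by lra.
    replace (-1 * (-1) ^ S k * - (t * bern_rem_par (2 * k + 1) d t * (/ 2 - x)))
      with (t * (/ 2 - x) * ((-1) ^ S k * bern_rem_par (2 * k + 1) d t)) by ring.
    apply Rmult_lt_0_compat; [apply Rmult_lt_0_compat; lra|lra].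
Qed.

Lemma bern_rem_par_sign k t x : 0 < t -> 0 < x < / 2 ->
  0 < (-1) ^ S k * bern_rem_par (2 * k) x t.
Proof.
intros Ht; revert x; induction k as [|k IH].
- intros x Hx; unfold bern_rem_par; simpl.
  enough (bern_gf x t < bern_gf (1 - x) t) by lra.
  unfold bern_gf; pose proof (exp_m1_pos t Ht).
  apply Rmult_lt_compat_r; [apply Rinv_0_lt_compat; lra|].
  apply Rmult_lt_compat_l; [exact Ht|].
  apply exp_increasing, Rmult_lt_compat_r; lra.
- now apply bern_rem_par_step.
Qed.

(** For odd index, [bern_rem_par] at $0$ is the sum of the remainders at $0$ and $1$. These agree
    once the index is at least 2, which is where $k \ge 1$ enters. *)
Lemma bern_rem_1_sign k t : (1 <= k)%nat -> 0 < t ->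
  0 < (-1) ^ k * bern_rem (2 * k + 1) 1 t.
Proof.
intros Hk Ht.
destruct (bern_rem_par_step k t Ht) as [H _].
{ intros x Hx; now apply bern_rem_par_sign. }
unfold bern_rem_par in H; rewrite pow_add, pow_1_even, Rminus_0_r in H.
destruct k as [|k]; [lia|].
replace (2 * S k + 1)%nat with (S (S (2 * k + 1))) in * by lia.
rewrite <- bern_rem_1_0 in H by exact Ht.
simpl pow in *; lra.
Qed.

(* [exp (- x t) * bern_rem (S n) x t] has [x]-derivative
   [t ^ (n + 1) * exp (- x t) * nbern n x]. *)
Lemma bern_rem_pos_transfer n s x y t : 0 < t -> x <= y ->
  (forall z, x < z < y -> s * nbern n z <= 0) ->
  0 < s * bern_rem (S n) y t -> 0 < s * bern_rem (S n) x t.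
Proof.
intros Ht Hxy Hz Hy.
set (F := fun x => - s * (exp (- x * t) * bern_rem (S n) x t)).
assert (H : F x <= F y).
{ apply is_derive_le with
    (fun x => - s * (exp (- x * t) * (t * (nbern n x * t ^ n)))); [exact Hxy| |].
  - intros z _; unfold F.
    apply (is_derive_scal (fun x => exp (- x * t) * bern_rem (S n) x t)).
    replace (exp (- z * t) * (t * (nbern n z * t ^ n))) with
      ((- t * exp (- z * t)) * bern_rem (S n) z t
        + exp (- z * t) * (t * bern_rem n z t)) by (simpl; ring).
    apply (is_derive_mult (fun x => exp (- x * t)) (fun x => bern_rem (S n) x t));
      [auto_derive; [trivial|ring]|apply is_derive_bern_rem|].
    intros; apply Rmult_comm.
  - intros z Hz2; pose proof (Hz z Hz2).
    replace (- s * (exp (- z * t) * (t * (nbern n z * t ^ n)))) with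
      (- (s * nbern n z) * (exp (- z * t) * t * t ^ n)) by ring.
    apply Rmult_le_pos; [lra|].
    repeat apply Rmult_le_pos; [apply Rlt_le, exp_pos|lra|apply pow_le; lra]. }
unfold F in H.
assert (H1 : 0 < exp (- y * t) * (s * bern_rem (S n) y t))
  by (apply Rmult_lt_0_compat; [apply exp_pos|exact Hy]).
apply Rmult_lt_reg_l with (exp (- x * t)); [apply exp_pos|]; lra.
Qed.

Lemma is_half_root_nbern n r : is_half_root n r -> 0 <= r <= / 2 /\ nbern n r = 0.
Proof.
intros [Hr H0]; split; [lra|].
rewrite bernoulliE in H0; apply Rmult_integral in H0.
destruct H0 as [H0|H0]; [now apply INR_fact_neq_0 in H0|exact H0].
Qed.

Lemma nbern_even_nonpos k r x : (1 <= k)%nat -> is_half_root (2 * k) r ->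
  0 <= x <= r -> (-1) ^ k * nbern (2 * k) x <= 0.
Proof.
intros Hk Hr Hx; apply is_half_root_nbern in Hr; destruct Hr as [Hr Hr0].
destruct (nbern_root k Hk) as [_ [_ [_ Hm]]].
{ intros y Hy; destruct k as [|k]; [lia|].
  replace (2 * S k - 1)%nat with (2 * k + 1)%nat by lia; now apply nbern_odd_sign. }
destruct (Req_dec x r) as [->|Hne]; [rewrite Hr0; lra|].
pose proof (Hm x r ltac:(lra) ltac:(lra) ltac:(lra)) as H; rewrite Hr0 in H; lra.
Qed.

(** Carry the sign from $1$ down to $1 - l$: by symmetry $B_{2k}$ on that interval takes its values
    on $[0, l]$, before the root. *)
Lemma bern_rem_even_sign k l r t : (1 <= k)%nat -> is_half_root (2 * k) r ->
  0 <= l <= r -> 0 < t -> 0 < (-1) ^ k * bern_rem (S (2 * k)) (1 - l) t.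
Proof.
intros Hk Hr Hl Ht; apply bern_rem_pos_transfer with 1; [exact Ht|lra| |].
- intros z Hz; replace z with (1 - (1 - z)) by ring.
  rewrite nbern_sym, pow_1_even, Rmult_1_l.
  apply nbern_even_nonpos with r; auto; lra.
- replace (S (2 * k)) with (2 * k + 1)%nat by lia; now apply bern_rem_1_sign.
Qed.

(** At $l = r$ the term of index $2k+2$ vanishes, so the remainder equals the next one and the even
    case applies. The sign of $B_{2k+1}$ on $(1/2, 1)$ carries it on to $l \ge r$. *)
Lemma bern_rem_odd_sign k l r t : is_half_root (2 * S k) r ->
  r <= l <= 1 / 2 -> 0 < t -> 0 < (-1) ^ S k * bern_rem (2 * S k) (1 - l) t.
Proof.
intros Hr Hl Ht.
destruct (is_half_root_nbern _ _ Hr) as [Hr1 Hr0].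
replace (2 * S k)%nat with (S (2 * k + 1)) by lia.
apply bern_rem_pos_transfer with (1 - r); [exact Ht|lra| |].
- intros z Hz; replace z with (1 - (1 - z)) by ring.
  rewrite nbern_sym, pow_add, pow_1_even.
  pose proof (nbern_odd_sign k (1 - z) ltac:(lra)); lra.
- replace (S (2 * k + 1)) with (2 * S k)%nat by lia.
  pose proof (bern_rem_even_sign (S k) r r t ltac:(lia) Hr ltac:(lra) Ht) as H.
  change (bern_rem (S (2 * S k)) (1 - r) t) with
    (bern_rem (2 * S k) (1 - r) t - nbern (2 * S k) (1 - r) * t ^ (2 * S k)) in H.
  rewrite nbern_sym, Hr0 in H; lra.
Qed.

Lemma bern_rem_sign N l r t :
  (1 <= N)%nat ->
  (Nat.Even N /\ unique (is_half_root N) r /\ 0 <= l <= r) \/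
  (Nat.Odd N /\ unique (is_half_root (N + 1)) r /\ r <= l <= 1 / 2) ->
  0 < t -> 0 < (-1) ^ Nat.div2 (N + 1) * bern_rem (S N) (1 - l) t.
Proof.
intros HN [[[k ->] [[Hr _] Hl]]|[[k ->] [[Hr _] Hl]]] Ht.
- replace (Nat.div2 (2 * k + 1)) with k
    by (rewrite Nat.add_1_r, Nat.div2_succ_double; reflexivity).
  apply bern_rem_even_sign with r; auto; lia.
- replace (2 * k + 1 + 1)%nat with (2 * S k)%nat in * by lia.
  rewrite Nat.div2_double.
  replace (S (2 * k + 1)) with (2 * S k)%nat by lia.
  now apply bern_rem_odd_sign with r.
Qed.

(** * Sums of shifts of a function *)

(* [u n] is [(-1) ^ n] times the [n]-th derivative of [u 0]. *)
Definition deriv_chain (l : R) (u : nat -> R -> R) : Prop :=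
  forall n x, l < x -> is_derive (u n) x (- u (S n) x).

Lemma deriv_chain_monotonic l u f :
  deriv_chain l u -> (forall n x, l < x -> 0 < u n x) ->
  (forall x, l < x -> f x = u 0%nat x) ->
  strictly_completely_monotonic (fun x => l < x) f.
Proof.
intros Hd Hp Hf.
(* The half-line is open, so identities holding on it can be differentiated. *)
assert (Hloc : forall x (P : R -> Prop), l < x -> (forall y, l < y -> P y) -> locally x P).
{ intros x P Hx HP; exists (mkposreal (x - l) ltac:(lra)); intros y Hy; apply HP.
  revert Hy; unfold ball; simpl; unfold AbsRing_ball, abs, minus, plus, opp; simpl.
  intros Hy; apply Rabs_def2 in Hy; lra. }
assert (H : forall n x, l < x -> ex_derive_n f n x /\ Derive_n f n x = (-1) ^ n * u n x).
{ induction n as [|n IH]; intros x Hx.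
  - split; [exact I|]; simpl; rewrite Hf by exact Hx; ring.
  - assert (HD : is_derive (Derive_n f n) x ((-1) ^ S n * u (S n) x)).
    { apply is_derive_ext_loc with (fun y => (-1) ^ n * u n y).
      - apply Hloc; [exact Hx|]; intros y Hy; symmetry; now apply IH.
      - replace ((-1) ^ S n * u (S n) x) with ((-1) ^ n * - u (S n) x)
          by (simpl; ring).
        apply (is_derive_scal (u n)), Hd, Hx. }
    split; [eexists; exact HD|now apply is_derive_unique]. }
intros x n Hx; destruct (H n x Hx) as [H1 H2]; split; [exact H1|].
rewrite H2, <- Rmult_assoc, <- Rpow_mult_distr.
replace (-1 * -1) with 1 by ring; rewrite pow1, Rmult_1_l; auto.
Qed.

Lemma deriv_chain_decr l u n x y :
  deriv_chain l u -> (forall x, l < x -> 0 < u (S n) x) ->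
  l < x -> x < y -> u n y < u n x.
Proof.
intros Hd Hp Hx Hxy.
destruct (is_derive_mvt (u n) (fun z => - u (S n) z) x y Hxy) as [c [Hc Hc2]].
- intros t Ht; apply Hd; lra.
- pose proof (Hp c ltac:(lra)); nra.
Qed.

(** Since [u 1] is strictly decreasing, a nonpositive value at $a$ would make [u 0] grow by at least
    a fixed amount at each later unit step, against its limit $0$. So [u 1] is positive, and [u 0]
    decreases strictly to $0$ along unit steps. *)
Lemma deriv_chain_pos l u :
  deriv_chain l u -> (forall n x, l < x -> 0 < u (S (S n)) x) ->
  (forall x, l < x -> is_lim_seq (fun n => u 0%nat (x + INR n)) 0) ->
  forall n x, l < x -> 0 < u n x.
Proof.
intros Hd Hp Hlim.
assert (H1 : forall x, l < x -> 0 < u 1%nat x).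
{ intros a Ha; apply Rnot_le_lt; intros Hn.
  (* Moving to $a + 1$ makes the inequality strict. *)
  assert (Ha1 : u 1%nat (a + 1) < 0).
  { apply Rlt_le_trans with (u 1%nat a); [|exact Hn].
    apply deriv_chain_decr with l; auto; lra. }
  assert (Hl : is_lim_seq (fun n => u 0%nat (a + 1 + INR (S n)) - u 0%nat (a + 1 + INR n))
    (0 - 0)).
  { apply is_lim_seq_minus'; [|apply Hlim; lra].
    apply (is_lim_seq_incr_1 (fun n => u 0%nat (a + 1 + INR n))), Hlim; lra. }
  enough (H : Rbar_le (- u 1%nat (a + 1)) (0 - 0)) by (simpl in H; lra).
  refine (is_lim_seq_le _ _ _ _ _ (is_lim_seq_const _) Hl).
  intros n; pose proof (pos_INR n); rewrite S_INR.
  destruct (is_derive_mvt (u 0%nat) (fun z => - u 1%nat z) (a + 1 + INR n)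
    (a + 1 + (INR n + 1))) as [c [Hc Hc2]]; [lra|intros; apply Hd; lra|].
  rewrite Hc.
  assert (u 1%nat c < u 1%nat (a + 1))
    by (apply deriv_chain_decr with l; auto; lra).
  lra. }
intros [|[|n]] x Hx; auto.
apply Rle_lt_trans with (u 0%nat (x + 1)); [|apply deriv_chain_decr with l; auto; lra].
enough (H : Rbar_le 0 (u 0%nat (x + 1))) by exact H.
refine (is_lim_seq_le _ _ _ _ _ (Hlim (x + 1) ltac:(lra)) (is_lim_seq_const _)).
intros [|n]; [right; f_equal; simpl; ring|].
left; apply deriv_chain_decr with l; auto; [lra|].
pose proof (lt_0_INR (S n) ltac:(lia)); lra.
Qed.

Lemma is_derive_quadratic (f : R -> R) (x a C d : R) : 0 < d ->
  (forall h, Rabs h < d -> Rabs (f (x + h) - f x - h * a) <= C * h ^ 2) ->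
  is_derive f x a.
Proof.
intros Hd H; apply is_derive_Reals; intros eps Heps.
assert (HC : 0 < Rabs C + 1) by (pose proof (Rabs_pos C); lra).
assert (He : 0 < eps / (Rabs C + 1)) by (apply Rdiv_lt_0_compat; lra).
exists (mkposreal _ (Rmin_pos _ _ Hd He)); intros h Hh0 Hh; simpl in Hh.
pose proof (Rmin_l d (eps / (Rabs C + 1))); pose proof (Rmin_r d (eps / (Rabs C + 1))).
replace ((f (x + h) - f x) / h - a) with ((f (x + h) - f x - h * a) / h)
  by (field; exact Hh0).
unfold Rdiv; rewrite Rabs_mult, Rabs_inv.
assert (Hp : 0 < Rabs h) by (apply Rabs_pos_lt; exact Hh0).
apply Rmult_lt_reg_r with (Rabs h); [exact Hp|].
rewrite Rmult_assoc, Rinv_l, Rmult_1_r by lra.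
eapply Rle_lt_trans; [apply H; lra|].
assert (Hhe : Rabs h * (Rabs C + 1) < eps).
{ apply Rmult_lt_reg_r with (/ (Rabs C + 1)); [apply Rinv_0_lt_compat; lra|].
  rewrite Rmult_assoc, Rinv_r, Rmult_1_r by lra; unfold Rdiv in *; lra. }
rewrite <- (pow2_abs h).
apply Rle_lt_trans with (Rabs h * Rabs C * Rabs h).
- replace (C * Rabs h ^ 2) with (C * (Rabs h * Rabs h)) by ring.
  replace (Rabs h * Rabs C * Rabs h) with (Rabs C * (Rabs h * Rabs h)) by ring.
  apply Rmult_le_compat_r; [nra|apply Rle_abs].
- apply Rmult_lt_compat_r; lra.
Qed.

Lemma MVT_between (F f : R -> R) (a b : R) :
  (forall t, Rmin a b <= t <= Rmax a b -> is_derive F t (f t)) ->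
  exists c, Rmin a b <= c <= Rmax a b /\ F b - F a = f c * (b - a).
Proof.
intros H; apply MVT_gen.
- intros t Ht; apply H; lra.
- intros t Ht; apply continuity_pt_filterlim, (ex_derive_continuous F).
  eexists; now apply H.
Qed.

Definition summable_chain (l : R) (u : nat -> R -> R) : Prop :=
  deriv_chain l u /\ (forall n x, l < x -> 0 < u n x) /\
  (forall x, l < x -> ex_series (fun k => u 0%nat (x + INR k))).

Lemma summable_chain_decr l u n x y :
  summable_chain l u -> l < x -> x <= y -> u n y <= u n x.
Proof.
intros [Hd [Hp _]] Hx [Hxy| <-]; [|apply Rle_refl].
apply Rlt_le, deriv_chain_decr with l; auto.
Qed.

(* [u (n + 1) (z + 1) <= u n z - u n (z + 1)], which telescopes. *)
Lemma ex_series_shift l u n x :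
  summable_chain l u -> l < x -> ex_series (fun k => u n (x + INR k)).
Proof.
intros Hu; pose proof Hu as [u_chain [u_pos u_series]].
destruct n as [|n]; [apply u_series|intros Hx].
apply ex_finite_lim_seq_incr with (M := u (S n) x + u n x).
- intros k; rewrite sum_Sn; unfold plus; cbn -[INR sum_n].
  pose proof (lt_0_INR (S k) ltac:(lia)).
  pose proof (u_pos (S n) (x + INR (S k)) ltac:(lra)); lra.
- intros k.
  enough (sum_n (fun k => u (S n) (x + INR k)) k <= u (S n) x + u n x - u n (x + INR k)).
  { eapply Rle_trans; [eassumption|].
    pose proof (pos_INR k); pose proof (u_pos n (x + INR k) ltac:(lra)); lra. }
  induction k as [|k IH].
  + rewrite sum_O. change (INR 0) with 0; rewrite Rplus_0_r; lra.
  + rewrite sum_Sn; unfold plus; cbn -[INR sum_n].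
    rewrite S_INR; pose proof (pos_INR k).
    destruct (is_derive_mvt (u n) (fun z => - u (S n) z) (x + INR k) (x + (INR k + 1)))
      as [c [Hc Hc2]]; [lra|intros; apply u_chain; lra|].
    pose proof (summable_chain_decr l u (S n) c (x + (INR k + 1)) Hu ltac:(lra) ltac:(lra)).
    lra.
Qed.

(** Two mean value steps write the error as $h (c - a)\, u_{n+2}(e)$. As $u_{n+2}$ is nonincreasing,
    its value at $a - d$ is a bound uniform in $h$. *)
Lemma summable_chain_taylor l u n a h d :
  summable_chain l u -> l < a - d -> Rabs h <= d ->
  Rabs (u n (a + h) - u n a + h * u (S n) a) <= h ^ 2 * u (S (S n)) (a - d).
Proof.
intros Hu Ha Hh; pose proof Hu as [u_chain [u_pos _]].
pose proof (Rabs_pos h).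
assert (Hb : forall z, Rmin a (a + h) <= z <= Rmax a (a + h) ->
  a - d <= z /\ Rabs (z - a) <= Rabs h).
{ intros z; unfold Rmin, Rmax, Rabs in *.
  destruct (Rle_dec a (a + h)), (Rcase_abs h), (Rcase_abs (z - a)); lra. }
destruct (MVT_between (u n) (fun z => - u (S n) z) a (a + h)) as [c [Hc Ec]].
{ intros t Ht; apply u_chain; apply Hb in Ht; lra. }
destruct (MVT_between (u (S n)) (fun z => - u (S (S n)) z) a c) as [e [He Ee]].
{ intros t Ht; apply u_chain; apply Hb in Hc.
  unfold Rmin in Ht; destruct (Rle_dec a c); lra. }
assert (He' : a - d <= e).
{ apply Hb in Hc; unfold Rmin in He; destruct (Rle_dec a c); lra. }
apply Hb in Hc; destruct Hc as [_ Hc].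
replace (u n (a + h) - u n a + h * u (S n) a)
  with (h * (c - a) * u (S (S n)) e) by (rewrite Ec; nra).
pose proof (u_pos (S (S n)) e ltac:(lra)).
pose proof (summable_chain_decr l u (S (S n)) (a - d) e Hu Ha He').
rewrite !Rabs_mult, (Rabs_pos_eq (u (S (S n)) e)), <- pow2_abs by lra.
pose proof (Rabs_pos (c - a)).
apply Rmult_le_compat; nra.
Qed.

(** Summing the Taylor bounds at $a = x + k$ leaves a total error of order $h^2$, with the
    convergent series of $u_{n+2}(x - d + k)$ as constant. *)
Lemma is_derive_shift_series l u n x : summable_chain l u -> l < x ->
  is_derive (fun x => Series (fun k => u n (x + INR k))) x
    (- Series (fun k => u (S n) (x + INR k))).
Proof.
intros Hu Hx; set (d := (x - l) / 2).
apply is_derive_quadratic with (Series (fun k => u (S (S n)) (x - d + INR k))) d;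
  [unfold d; lra|].
intros h Hh.
assert (Hd : l < x - d) by (unfold d; lra).
assert (Hxh : l < x + h) by (apply Rabs_def2 in Hh; unfold d in *; lra).
pose proof (ex_series_shift l u n (x + h) Hu Hxh) as S1.
pose proof (ex_series_shift l u n x Hu Hx) as S2.
pose proof (ex_series_shift l u (S n) x Hu Hx) as S3.
pose proof (ex_series_shift l u (S (S n)) (x - d) Hu Hd) as S4.
assert (HB : forall k, 0 <= Rabs (u n (x + h + INR k) - u n (x + INR k)
    + h * u (S n) (x + INR k)) <= h ^ 2 * u (S (S n)) (x - d + INR k)).
{ intros k; split; [apply Rabs_pos|]; pose proof (pos_INR k).
  replace (x + h + INR k) with (x + INR k + h) by ring.
  replace (x - d + INR k) with (x + INR k - d) by ring.
  apply summable_chain_taylor with l; auto; lra. }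
replace (Series (fun k => u n (x + h + INR k)) - Series (fun k => u n (x + INR k))
  - h * - Series (fun k => u (S n) (x + INR k))) with
  (Series (fun k => u n (x + h + INR k) - u n (x + INR k) + h * u (S n) (x + INR k))).
- eapply Rle_trans; [apply Series_Rabs|].
  + apply (ex_series_le (V := R_CompleteNormedModule) _
      (fun k => h ^ 2 * u (S (S n)) (x - d + INR k))).
    * intros k; unfold norm; simpl; unfold abs; simpl.
      rewrite Rabs_Rabsolu; apply HB.
    * apply (ex_series_scal (h ^ 2) _ S4).
  + rewrite Rmult_comm, <- Series_scal_l.
    apply Series_le; [exact HB|apply (ex_series_scal (h ^ 2) _ S4)].
- rewrite Series_plus, Series_minus, Series_scal_l; auto; [ring| |].
  + apply (ex_series_minus (V := R_NormedModule)); auto.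
  + apply (ex_series_scal h _ S3).
Qed.

Lemma shift_series_monotonic l u (f : R -> R) :
  deriv_chain l u -> (forall n x, l < x -> 0 < u n x) ->
  (forall x, l < x -> is_series (fun k => u 0%nat (x + INR k)) (f x)) ->
  strictly_completely_monotonic (fun x => l < x) f.
Proof.
intros Hd Hp Hf.
assert (Hu : summable_chain l u)
  by (split; [|split]; auto; intros x Hx; exists (f x); auto).
apply deriv_chain_monotonic with
  (fun n x => Series (fun k => u n (x + INR k))).
- intros n x Hx; now apply (is_derive_shift_series l).
- intros n x Hx.
  (* The first term is already positive and the remaining ones are nonnegative. *)
  apply Rlt_le_trans with (u n (x + INR 0)); [apply Hp; simpl; lra|].
  rewrite Series_incr_1 by now apply ex_series_shift with l.
  enough (0 <= Series (fun k => u n (x + INR (S k)))) by lra.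
  rewrite <- (Rmult_0_l (Series (fun k => u n (x + INR (S k))))), <- Series_scal_l.
  apply Series_le.
  + intros k; rewrite Rmult_0_l; split; [lra|]; apply Rlt_le, Hp.
    pose proof (pos_INR (S k)); lra.
  + apply (ex_series_incr_1 (fun k => u n (x + INR k))); now apply ex_series_shift with l.
- intros x Hx; symmetry; now apply is_series_unique, Hf.
Qed.

(** * The difference equation *)

Lemma is_derive_pow_laplace k y : 0 < y ->
  is_derive (pow_laplace k) y (- pow_laplace (S k) y).
Proof.
intros Hy; unfold pow_laplace; auto_derive.
- apply Rmult_integral_contrapositive_currified; [|apply pow_nonzero]; lra.
- rewrite fact_simpl, mult_INR.
  change (match k with 0%nat => 1 | S _ => INR k + 1 end) with (INR (S k)).
  simpl; field; split; [apply pow_nonzero|]; lra.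
Qed.

Lemma is_lim_pow_laplace k : is_lim (pow_laplace k) p_infty 0.
Proof.
apply is_lim_le_le_loc with (fun _ => 0) (fun y => INR (fact k) / (y + 0)).
- exists 1; intros y Hy; pose proof (INR_fact_lt_0 k).
  assert (H1 : 1 <= y ^ k) by (apply pow_R1_Rle; lra).
  unfold pow_laplace; split.
  + apply Rlt_le, Rdiv_lt_0_compat; [lra|apply pow_lt; lra].
  + apply Rmult_le_compat_l; [lra|]; rewrite Rplus_0_r; simpl.
    apply Rinv_le_contravar; [lra|nra].
- apply is_lim_const.
- apply is_lim_inv_shift.
Qed.

(* The [j]-th derivative, up to the sign [(-1) ^ j], of the sum in [L], since
   [pow_laplace (n - 2) y = (n - 2)! y ^ (1 - n)]. *)
Definition L_tail (b : nat -> R) (N j : nat) (y : R) : R :=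
  sum_n_m (fun n => b n * pow_laplace (n - 2 + j) y) 2 N.

Lemma L_tail_1 b j y : L_tail b 1 j y = 0.
Proof. apply (sum_n_m_zero (G := R_AbelianGroup)); lia. Qed.

Lemma L_tail_S b N j y : (1 <= N)%nat ->
  L_tail b (S N) j y = L_tail b N j y + b (S N) * pow_laplace (S N - 2 + j) y.
Proof. intros HN; apply (sum_n_Sm (G := R_AbelianGroup)); lia. Qed.

Lemma is_derive_L_tail b N j y : (1 <= N)%nat -> 0 < y ->
  is_derive (L_tail b N j) y (- L_tail b N (S j) y).
Proof.
intros HN Hy; induction N as [|N IH]; [lia|].
destruct N as [|N].
- rewrite L_tail_1, Ropp_0.
  apply is_derive_ext with (fun _ => 0); [intros t; now rewrite L_tail_1|].
  apply @is_derive_const.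
- apply is_derive_ext with
    (fun t => L_tail b (S N) j t + b (S (S N)) * pow_laplace (S (S N) - 2 + j) t);
    [intros t; symmetry; apply L_tail_S; lia|].
  rewrite L_tail_S by lia.
  replace (S (S N) - 2 + S j)%nat with (S (S (S N) - 2 + j)) by lia.
  rewrite Ropp_plus_distr, Ropp_mult_distr_r.
  apply (is_derive_plus (L_tail b (S N) j)
    (fun t => b (S (S N)) * pow_laplace (S (S N) - 2 + j) t)); [apply IH; lia|].
  apply (is_derive_scal (pow_laplace _)), is_derive_pow_laplace, Hy.
Qed.

Lemma is_lim_L_tail b N : (1 <= N)%nat -> is_lim (L_tail b N 0) p_infty 0.
Proof.
intros HN; induction N as [|N IH]; [lia|]; destruct N as [|N].
- apply is_lim_ext with (fun _ => 0); [intros t; now rewrite L_tail_1|].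
  apply is_lim_const.
- apply is_lim_ext with
    (fun t => L_tail b (S N) 0 t + b (S (S N)) * pow_laplace (S (S N) - 2 + 0) t);
    [intros t; symmetry; apply L_tail_S; lia|].
  replace (Finite 0) with (Finite (0 + b (S (S N)) * 0)) by (f_equal; ring).
  apply is_lim_plus'; [apply IH; lia|].
  apply (is_lim_scal_l (pow_laplace _) _ p_infty 0), is_lim_pow_laplace.
Qed.

(* [(-1) ^ n] times the [n]-th derivative of [L N l] at [y + l], without the
   constant term. *)
Definition L_deriv (l : R) (N n : nat) (y : R) : R :=
  let b n := nbern n (1 - l) in
  match n with
  | O => (y + (l - / 2)) * ln y - y + L_tail b N 0 y
  | S O => - ln y + b 1%nat * pow_laplace 0 y + L_tail b N 1 y
  | S (S m) => pow_laplace m y + b 1%nat * pow_laplace (S m) y + L_tail b N n y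
  end.

Lemma is_derive_L_deriv l N n y : (1 <= N)%nat -> 0 < y ->
  is_derive (L_deriv l N n) y (- L_deriv l N (S n) y).
Proof.
intros HN Hy.
pose proof (fun j => is_derive_L_tail (fun n => nbern n (1 - l)) N j y HN Hy) as HT.
assert (HP : forall k, is_derive (fun y => nbern 1 (1 - l) * pow_laplace k y) y
  (nbern 1 (1 - l) * - pow_laplace (S k) y)).
{ intros k; apply (is_derive_scal (pow_laplace k)), is_derive_pow_laplace, Hy. }
destruct n as [|[|m]].
- replace (- L_deriv l N 1 y) with
    ((ln y - nbern 1 (1 - l) * pow_laplace 0 y)
      + - L_tail (fun n => nbern n (1 - l)) N 1 y) by (unfold L_deriv; ring).
  apply (is_derive_plus (fun y => (y + (l - / 2)) * ln y - y)); [|apply HT].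
  auto_derive; [exact Hy|].
  rewrite nbern_1_r; unfold pow_laplace; simpl; field; lra.
- replace (- L_deriv l N 2 y) with
    (- pow_laplace 0 y + nbern 1 (1 - l) * - pow_laplace 1 y
      + - L_tail (fun n => nbern n (1 - l)) N 2 y) by (unfold L_deriv; ring).
  apply (is_derive_plus (fun y => - ln y + nbern 1 (1 - l) * pow_laplace 0 y));
    [|apply HT].
  apply (is_derive_plus (fun y => - ln y)); [|apply HP].
  auto_derive; [exact Hy|unfold pow_laplace; simpl; field; lra].
- replace (- L_deriv l N (S (S (S m))) y) with
    (- pow_laplace (S m) y + nbern 1 (1 - l) * - pow_laplace (S (S m)) y
      + - L_tail (fun n => nbern n (1 - l)) N (S (S (S m))) y)
    by (unfold L_deriv; ring).
  apply (is_derive_plus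
    (fun y => pow_laplace m y + nbern 1 (1 - l) * pow_laplace (S m) y)); [|apply HT].
  apply (is_derive_plus (pow_laplace m)); [|apply HP].
  apply is_derive_pow_laplace, Hy.
Qed.

(** The coefficients match because $(-1)^n B_n(\lambda) = B_n(1 - \lambda)$ and $n! =
    n(n-1)(n-2)!$. *)
Lemma L_deriv_0 l N x : l < x ->
  L N l x = ln (sqrt (2 * PI)) + L_deriv l N 0 (x - l).
Proof.
intros Hx; unfold L, L_deriv, L_tail.
rewrite (sum_n_m_ext_loc _ (fun n => nbern n (1 - l) * pow_laplace (n - 2 + 0) (x - l))).
- replace (x - l + (l - / 2)) with (x - 1 / 2) by field; ring.
- intros [|[|m]] Hm; [lia|lia|].
  rewrite bernoulliE, nbern_sym; unfold pow_laplace.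
  replace (S (S m) - 2 + 0)%nat with m by lia.
  replace (1 - Z.of_nat (S (S m)))%Z with (- Z.of_nat (S m))%Z by lia.
  rewrite powerRZ_neg', <- pow_powerRZ.
  change (fact (S (S m))) with (S (S m) * (S m * fact m))%nat.
  rewrite !mult_INR, !(S_INR (S m)), (S_INR m).
  pose proof (pos_INR m).
  match goal with |- ?a = ?b => change (@eq R a b) end.
  field; repeat split; try lra; apply pow_nonzero; lra.
Qed.

(** The last factor is the polynomial of the terms of index at most $N$, and each monomial
    transforms into one [pow_laplace]. Two derivatives are taken first because only then has every
    logarithm become a power. *)
Lemma improper_int_L_deriv l N m y : (1 <= N)%nat -> 0 < y ->
  improper_int
    (fun t => t ^ m * exp (- y * t) * (bern_gf (1 - l) t - bern_rem (S N) (1 - l) t))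
    (L_deriv l N (S (S m)) y).
Proof.
intros HN Hy; induction N as [|N IH]; [lia|]; destruct N as [|N].
- apply improper_int_ext with (fun t => 1 * (t ^ m * exp (- y * t)) +
    nbern 1 (1 - l) * (t ^ S m * exp (- y * t))).
  { intros t Ht; simpl; rewrite nbern_0_r; ring. }
  unfold L_deriv; rewrite L_tail_1, Rplus_0_r.
  rewrite <- (Rmult_1_l (pow_laplace m y)).
  apply improper_int_lin; apply improper_int_pow_laplace, Hy.
- set (N' := S N) in *.
  apply improper_int_ext with (fun t => 1 * (t ^ m * exp (- y * t) *
      (bern_gf (1 - l) t - bern_rem (S N') (1 - l) t)) +
    nbern (S N') (1 - l) * (t ^ (S N' + m) * exp (- y * t))).
  { intros t Ht.
    change (bern_rem (S (S N')) (1 - l) t) with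
      (bern_rem (S N') (1 - l) t - nbern (S N') (1 - l) * t ^ S N').
    rewrite pow_add; ring. }
  replace (L_deriv l (S N') (S (S m)) y) with (1 * L_deriv l N' (S (S m)) y +
    nbern (S N') (1 - l) * pow_laplace (S N' + m) y).
  + apply improper_int_lin; [apply IH; lia|apply improper_int_pow_laplace, Hy].
  + unfold L_deriv; rewrite L_tail_S by lia.
    replace (S N' - 2 + S (S m))%nat with (S N' + m)%nat by lia; ring.
Qed.

(** $(-1)^n$ times the $n$-th derivative of $\ln x = \ln\Gamma(x+1) - \ln\Gamma(x)$. *)
Definition ln_deriv (n : nat) (x : R) : R :=
  match n with O => ln x | S m => - pow_laplace m x end.

Lemma is_derive_ln_deriv n x : 0 < x -> is_derive (ln_deriv n) x (- ln_deriv (S n) x).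
Proof.
intros Hx; destruct n as [|m].
- unfold ln_deriv; auto_derive; [exact Hx|unfold pow_laplace; simpl; field; lra].
- apply (is_derive_opp (pow_laplace m) x (- pow_laplace (S m) x)).
  now apply is_derive_pow_laplace.
Qed.

(* [(-1) ^ n] times the [n]-th derivative of [s (f x - f (x + 1))] where
   [f = ln Gamma - L]. *)
Definition diff_deriv (s l : R) (N n : nat) (x : R) : R :=
  s * (L_deriv l N n (x - l + 1) - L_deriv l N n (x - l) - ln_deriv n x).

Lemma diff_deriv_chain s l N : (1 <= N)%nat -> 0 <= l ->
  deriv_chain l (diff_deriv s l N).
Proof.
intros HN Hl n x Hx; unfold diff_deriv; rewrite Ropp_mult_distr_r.
apply (is_derive_scal (fun x =>
  L_deriv l N n (x - l + 1) - L_deriv l N n (x - l) - ln_deriv n x)).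
replace (- (L_deriv l N (S n) (x - l + 1) - L_deriv l N (S n) (x - l) - ln_deriv (S n) x))
  with (1 * - L_deriv l N (S n) (x - l + 1) - 1 * - L_deriv l N (S n) (x - l)
    - - ln_deriv (S n) x) by ring.
apply (is_derive_minus
  (fun x => L_deriv l N n (x - l + 1) - L_deriv l N n (x - l)) (ln_deriv n));
  [|apply is_derive_ln_deriv; lra].
apply (is_derive_minus
  (fun x => L_deriv l N n (x - l + 1)) (fun x => L_deriv l N n (x - l))).
- apply (is_derive_comp (L_deriv l N n) (fun x => x - l + 1));
    [apply is_derive_L_deriv; [exact HN|lra]|auto_derive; [trivial|ring]].
- apply (is_derive_comp (L_deriv l N n) (fun x => x - l));
    [apply is_derive_L_deriv; [exact HN|lra]|auto_derive; [trivial|ring]].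
Qed.

Lemma diff_deriv_pos s l N m x : (1 <= N)%nat -> 0 <= l -> l < x ->
  (forall t, 0 < t -> 0 < s * bern_rem (S N) (1 - l) t) ->
  0 < diff_deriv s l N (S (S m)) x.
Proof.
intros HN Hl Hx Hs; unfold diff_deriv, ln_deriv.
set (g := fun t => bern_gf (1 - l) t - bern_rem (S N) (1 - l) t).
set (v := L_deriv l N (S (S m)) (x - l + 1)).
set (w := L_deriv l N (S (S m)) (x - l)).
replace (s * (v - w - - pow_laplace (S m) x))
  with (s * (1 * v + -1 * w) + s * pow_laplace (S m) x) by ring.
eapply improper_int_pos.
- apply (improper_int_lin
    (fun t => 1 * (t ^ m * exp (- (x - l + 1) * t) * g t)
      + -1 * (t ^ m * exp (- (x - l) * t) * g t))
    (fun t => t ^ S m * exp (- x * t))).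
  + apply improper_int_lin; apply improper_int_L_deriv; auto; lra.
  + apply improper_int_pow_laplace; lra.
- intros t Ht; cbv beta.
  (* This turns the transform coming from $\ln x$ into the full generating function, which cancels
     against the one in [g] and leaves only the remainder. *)
  assert (Eg : t * exp (- l * t) = (1 - exp (- t)) * bern_gf (1 - l) t).
  { unfold bern_gf; pose proof (exp_m1_pos t Ht).
    replace ((1 - l) * t) with (t + - l * t) by ring.
    rewrite exp_plus, exp_Ropp; field; lra. }
  replace (- (x - l + 1) * t) with (- (x - l) * t + - t) by ring.
  replace (- x * t) with (- (x - l) * t + - l * t) by ring.
  rewrite !exp_plus.
  replace (t ^ S m * (exp (- (x - l) * t) * exp (- l * t)))
    with (t ^ m * exp (- (x - l) * t) * (t * exp (- l * t))) by (simpl; ring).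
  rewrite Eg; unfold g.
  match goal with |- 0 < ?e => replace e with (t ^ m * exp (- (x - l) * t) *
    (1 - exp (- t)) * (s * bern_rem (S N) (1 - l) t)) by ring end.
  apply Rmult_lt_0_compat; [|now apply Hs].
  apply Rmult_lt_0_compat.
  + apply Rmult_lt_0_compat; [now apply pow_lt|apply exp_pos].
  + pose proof (exp_increasing (- t) 0 ltac:(lra)); rewrite exp_0 in *; lra.
Qed.

(** Besides the Stirling error, replacing $\ln x$ by $\ln(x - \lambda)$ contributes $\lambda$ in the
    limit, and replacing $x$ by $x - \lambda$ in the linear term contributes $-\lambda$. *)
Lemma ln_Gamma_minus_L_lim l N x : (1 <= N)%nat -> 0 <= l -> l < x ->
  is_lim_seq (fun n => ln (Gamma (x + INR n)) - L N l (x + INR n)) 0.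
Proof.
intros HN Hl Hx.
set (r := fun y => (y + (l - / 2)) * (ln (y + l) - ln y)
  - L_tail (fun n => nbern n (1 - l)) N 0 y).
apply is_lim_seq_ext with
  (fun n => (stirling_err (x + INR n) - ln (sqrt (2 * PI))) + (r (x - l + INR n) - l)).
{ intros n; pose proof (pos_INR n); rewrite L_deriv_0 by lra.
  unfold stirling_err, r, L_deriv.
  replace (x + INR n - l) with (x - l + INR n) by ring.
  replace (x - l + INR n + l) with (x + INR n) by ring; ring. }
replace (Finite 0) with
  (Finite ((ln (sqrt (2 * PI)) - ln (sqrt (2 * PI))) + ((l - 0) - l)))
  by (f_equal; ring).
apply is_lim_seq_plus'.
- apply is_lim_seq_minus'; [apply stirling_err_lim; lra|apply is_lim_seq_const].
- apply is_lim_seq_minus'; [|apply is_lim_seq_const].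
  apply (is_lim_comp_seq r (fun n => x - l + INR n) p_infty).
  + apply is_lim_minus'; [now apply is_lim_ln_quotient|now apply is_lim_L_tail].
  + exists 0%nat; discriminate.
  + apply (is_lim_seq_plus (fun _ => x - l) INR (x - l) p_infty);
      [apply is_lim_seq_const|apply is_lim_seq_INR|reflexivity].
Qed.

Lemma diff_deriv_0 s l N x : 0 <= l -> l < x ->
  diff_deriv s l N 0 x = s * (ln (Gamma x) - L N l x)
    - s * (ln (Gamma (x + 1)) - L N l (x + 1)).
Proof.
intros Hl Hx; unfold diff_deriv, ln_deriv.
rewrite ln_Gamma_succ, !L_deriv_0 by lra.
replace (x + 1 - l) with (x - l + 1) by ring; ring.
Qed.

Lemma is_series_telescope (u : nat -> R) :
  is_lim_seq u 0 -> is_series (fun k => u k - u (S k)) (u 0%nat).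
Proof.
intros Hu; apply filterlim_ext with (fun n => u 0%nat - u (S n)).
{ intros n; induction n as [|n IH]; [now rewrite sum_O|].
  rewrite sum_Sn, <- IH; unfold plus; simpl; ring. }
assert (H : is_lim_seq (fun n => u 0%nat - u (S n)) (u 0%nat - 0)).
{ apply is_lim_seq_minus'; [apply is_lim_seq_const|].
  now apply is_lim_seq_incr_1 in Hu. }
rewrite Rminus_0_r in H; exact H.
Qed.

Theorem theorem1p2 (N : nat) (lambda lambda0 : R)
  (hN : (1 <= N)%nat)
  (hlambda :
    (Nat.Even N /\ unique (is_half_root N) lambda0 /\
       0 <= lambda <= lambda0) \/
    (Nat.Odd N /\ unique (is_half_root (N + 1)) lambda0 /\
       lambda0 <= lambda <= 1 / 2)) :
  strictly_completely_monotonic (fun x : R => lambda < x)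
    (fun x : R =>
       (-1) ^ (Nat.div2 (N + 1)) * (ln (Gamma x) - L N lambda x)).
Proof.
set (s := (-1) ^ Nat.div2 (N + 1)).
(* In the odd case this comes from $\lambda_0 \ge 0$. *)
assert (Hl : 0 <= lambda).
{ destruct hlambda as [[_ [_ H]]|[_ [[[H0 _] _] H]]]; lra. }
set (f := fun x => s * (ln (Gamma x) - L N lambda x)).
assert (Hlim : forall x, lambda < x -> is_lim_seq (fun n => f (x + INR n)) 0).
{ intros x Hx; replace (Finite 0) with (Rbar_mult s 0) by (simpl; f_equal; ring).
  apply (is_lim_seq_scal_l (fun n => ln (Gamma (x + INR n)) - L N lambda (x + INR n))).
  now apply ln_Gamma_minus_L_lim. }
assert (Hdiff : forall x n, lambda < x ->
  f (x + INR n) - f (x + INR (S n)) = diff_deriv s lambda N 0 (x + INR n)).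
{ intros x n Hx; pose proof (pos_INR n); rewrite diff_deriv_0 by lra.
  unfold f; rewrite S_INR, Rplus_assoc; reflexivity. }
pose proof (diff_deriv_chain s lambda N hN Hl) as Hc.
apply shift_series_monotonic with (diff_deriv s lambda N).
- exact Hc.
- apply deriv_chain_pos; [exact Hc| |].
  + intros n x Hx; apply diff_deriv_pos; auto.
    intros t Ht; now apply bern_rem_sign with lambda0.
  (* Along unit shifts the difference tends to $0$ because both of its terms do. *)
  + intros x Hx; apply is_lim_seq_ext with (fun n => f (x + INR n) - f (x + INR (S n)));
      [intros n; now apply Hdiff|].
    replace (Finite 0) with (Finite (0 - 0)) by (f_equal; ring).
    apply is_lim_seq_minus'; [now apply Hlim|].
    apply (is_lim_seq_incr_1 (fun n => f (x + INR n))); now apply Hlim.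
- intros x Hx; apply is_series_ext with (fun n => f (x + INR n) - f (x + INR (S n)));
    [intros n; now apply Hdiff|].
  replace (f x) with (f (x + INR 0)) by (f_equal; simpl; ring).
  apply (is_series_telescope (fun n => f (x + INR n))); now apply Hlim.
Qed.
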